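(* Let ${\mathscr X}$ be a second countable metrizable space with countable basis ${\mathscr U}$, and let $\alpha_m=\{A_\varepsilon:\varepsilon\in{\mathscr E}_m\}$, $m\ge0$, be a dyadic tree of Borel partitions generated by ${\mathscr U}$ ($A_{\emptyset}={\mathscr X}$, $A_\varepsilon=A_{\varepsilon0}\cup A_{\varepsilon1}$ disjointly) that resolves ${\mathscr X}$. Let $\{\beta_\varepsilon\}\subset(0,\infty)$ define Pólya tree histogram distributions $\Pi_{\alpha_m}$, and assume there is a Borel probability measure on $M^1({\mathscr X})$ with the tight topology projecting to all $\Pi_{\alpha_m}$ (so the mean histograms are projections of a Borel probability measure $G$). If $$\sup_{m\ge1}\sum_{\varepsilon=e_1\cdots e_m\in{\mathscr E}_m}\prod_{l=1}^m\frac{1}{\beta_{\varepsilon_{l-1}0}+\beta_{\varepsilon_{l-1}1}}\Bigl(\frac{\beta_{\hat\varepsilon_l}}{\beta_{\varepsilon_{l-1}0}+\beta_{\varepsilon_{l-1}1}+1}+\beta_{\varepsilon_l}\Bigr)<\infty,$$ then there exists a unique Radon probability measure $\Pi$ on $M^1({\mathscr X})$ with the weak topology projecting to $\Pi_{\alpha_m}$ for all $m\ge1$; moreover $\Pi(\{P:P\ll G\})=1$.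
   Context: ${\mathscr E}_m$: binary strings of length $m$; ${\mathscr E}=\bigcup_m{\mathscr E}_m$; for $\varepsilon=e_1\cdots e_m$, $\varepsilon_l=e_1\cdots e_l$ ($\varepsilon_0$ empty) and $\hat\varepsilon_l=e_1\cdots e_{l-1}(1-e_l)$. A partition is generated by ${\mathscr U}$ if each of its sets is a finite union of finite intersections of sets $U$ or ${\mathscr X}\setminus U$, $U\in{\mathscr U}$; resolving means the partition sets generate the Borel $\sigma$-algebra. Pólya tree histograms: independent $V_{\varepsilon0}\sim\mathrm{Beta}(\beta_{\varepsilon0},\beta_{\varepsilon1})$, $V_{\varepsilon1}=1-V_{\varepsilon0}$, $P(A_{e_1\cdots e_m})=\prod_{l=1}^mV_{e_1\cdots e_l}$, and $\Pi_{\alpha_m}$ is the law of $(P(A_\varepsilon))_{\varepsilon\in{\mathscr E}_m}$. Tight topology: via bounded continuous functions; weak topology: via bounded Borel functions. $G$ is the mean measure $G(A)=\int P(A)\,d\Pi(P)$. *)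

(* Defs.v *)
From HB Require Import structures.
From mathcomp Require Import all_boot all_order all_algebra.
From mathcomp Require Import all_classical all_reals all_analysis.
Set Implicit Arguments. Unset Strict Implicit. Unset Printing Implicit Defensive.
Import Order.TTheory GRing.Theory Num.Theory.
Import numFieldNormedType.Exports.
Local Open Scope classical_set_scope.
Local Open Scope ring_scope.

Section dirac_prob.
Context d (T : measurableType d) (R : realType) (a : T).
Lemma dirac_prob_setT : (@dirac d T a R) setT = 1%E.
Proof. by rewrite /dirac indicT. Qed.
HB.instance Definition _ :=
  @Measure_isProbability.Build _ _ _ (@dirac d T a R) dirac_prob_setT.
End dirac_prob.

Definition gen_open {T : Type} (S : set (set T)) : set (set T) :=
  [set W | forall x, W x -> exists (n : nat) (F : nat -> set T),
      (forall i, (i < n)%N -> S (F i) /\ F i x) /\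
      (forall y, (forall i, (i < n)%N -> F i y) -> W y)].

Definition gen_compact {T : Type} (O : set (set T)) (K : set T) : Prop :=
  forall Cs : set (set T), Cs `<=` O -> K `<=` \bigcup_(C in Cs) C ->
    exists (n : nat) (F : nat -> set T),
      (forall i, (i < n)%N -> Cs (F i)) /\ K `<=` \bigcup_(i in `I_n) F i.

Definition borelType (X : ptopologicalType) := g_sigma_algebraType (@open X).

Definition generated_by {X : Type} (Us : set (set X)) (B : set X) : Prop :=
  exists (n : nat) (k : nat -> nat) (C : nat -> nat -> set X),
    (forall i j, Us (C i j) \/ exists W, Us W /\ C i j = ~` W) /\
    B = \bigcup_(i in `I_n) \bigcap_(j in `I_(k i)) C i j.

Definition dyadic_tree {X : Type} (A : seq bool -> set X) : Prop :=
  A [::] = setT /\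
  forall e, A e = A (rcons e false) `|` A (rcons e true) /\
            A (rcons e false) `&` A (rcons e true) = set0.

Definition resolving {X : topologicalType} (A : seq bool -> set X) : Prop :=
  <<s range A >> = <<s @open X >>.

Section spaces_of_measures.
Context (R : realType) (X : pseudoPMetricType R).

Definition M1 : Type := probability (borelType X) R.
HB.instance Definition _ := gen_eqMixin M1.
HB.instance Definition _ := gen_choiceMixin M1.
HB.instance Definition _ :=
  isPointed.Build M1 (@dirac _ (borelType X) (point : X) R : probability _ R).

Definition tight_sub : set (set M1) :=
  [set W | exists (f : X -> R) (O : set R),
     continuous f /\ (exists M : R, forall x, `|f x| <= M) /\ open O /\
     W = [set P : M1 | O (\int[P]_x f x)]].

Definition weak_sub : set (set M1) :=
  [set W | exists (f : borelType X -> R) (O : set R),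
     measurable_fun setT f /\ (exists M : R, forall x, `|f x| <= M) /\ open O /\
     W = [set P : M1 | O (\int[P]_x f x)]].

Definition tight_open := gen_open tight_sub.
Definition weak_open := gen_open weak_sub.

Definition M1tight := g_sigma_algebraType tight_open.
Definition M1weak := g_sigma_algebraType weak_open.

Definition radon (Pi : probability M1weak R) : Prop :=
  forall B : set M1weak, measurable B ->
    Pi B = ereal_sup [set Pi K | K in [set K | gen_compact weak_open K /\ K `<=` B]].

End spaces_of_measures.

Section beta_law.
Context (R : realType).
Definition beta_dens (a b : R) (x : R) : R :=
  x `^ (a - 1) * (1 - x) `^ (b - 1).
Definition beta_const (a b : R) : R :=
  \int[@lebesgue_measure R]_(x in `[0, 1]) beta_dens a b x.
Definition beta_law (a b : R) (B : set R) : \bar R :=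
  (\int[@lebesgue_measure R]_(x in B `&` `[0%R, 1%R]) (beta_dens a b x / beta_const a b)%:E)%E.
End beta_law.

Definition mutually_independent (R : realType) (dO : measure_display)
  (Om : measurableType dO) (Pr : probability Om R) (I : eqType)
  (Y : I -> Om -> R) : Prop :=
  forall (s : seq I) (B : I -> set R), uniq s -> (forall i, measurable (B i)) ->
    fine (Pr (\bigcap_(i in [set i | i \in s]) (Y i @^-1` B i))) =
    \prod_(i <- s) fine (Pr (Y i @^-1` B i)).

Definition polya_variables (R : realType) (beta : seq bool -> R)
  (dO : measure_display) (Om : measurableType dO) (Pr : probability Om R)
  (V : seq bool -> Om -> R) : Prop :=
  (forall e, measurable_fun setT (V e)) /\
  (forall e w, V (rcons e true) w = 1 - V (rcons e false) w) /\
  (forall e B, measurable B ->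
     Pr (V (rcons e false) @^-1` B) =
     beta_law (beta (rcons e false)) (beta (rcons e true)) B) /\
  mutually_independent Pr (fun e => V (rcons e false)).

Definition polya_hist (R : realType) (dO : measure_display)
  (Om : measurableType dO) (V : seq bool -> Om -> R) (m : nat) (w : Om) :
  m.-tuple bool -> R :=
  fun e => \prod_(l < m) V (take l.+1 (tval e)) w.

Definition borel_Em (R : realType) (m : nat) : set (set (m.-tuple bool -> R)) :=
  <<s [set C | exists (e : m.-tuple bool) (B : set R),
          measurable B /\ C = [set x : m.-tuple bool -> R | B (x e)]] >>.

Definition histogram (R : realType) (X : pseudoPMetricType R)
  (A : seq bool -> set X) (m : nat) (P : M1 X) : m.-tuple bool -> R :=
  fun e => fine (P (A (tval e))).

Definition projects_to (R : realType) (X : pseudoPMetricType R)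
  (A : seq bool -> set X) (dO : measure_display) (Om : measurableType dO)
  (Pr : probability Om R) (V : seq bool -> Om -> R)
  (mu : set (M1 X) -> \bar R) (m : nat) : Prop :=
  forall B, @borel_Em R m B ->
    mu [set P | B (@histogram R X A m P)] = Pr [set w | B (@polya_hist R dO Om V m w)].

(* the l-th factor (l = 0, ..., m-1, i.e. paper's l+1) in the summability
   condition *)
Definition polya_term (R : realType) (beta : seq bool -> R) (e : seq bool)
  (l : nat) : R :=
  let p := take l e in
  let b := nth false e l in
  let s := beta (rcons p false) + beta (rcons p true) in
  s^-1 * (beta (rcons p (~~ b)) / (s + 1) + beta (rcons p b)).

Definition mean_measure (R : realType) (X : pseudoPMetricType R)
  (A : seq bool -> set X) (dO : measure_display) (Om : measurableType dO)
  (Pr : probability Om R) (V : seq bool -> Om -> R)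
  (G : set (borelType X) -> \bar R) : Prop :=
  forall e, G (A e) = (\int[Pr]_w (\prod_(l < size e) V (take l.+1 e) w)%:E)%E.

(* Main.v *)
Require Import Defs.
From HB Require Import structures.
From mathcomp Require Import all_boot all_order all_algebra.
From mathcomp Require Import all_classical all_reals all_analysis.
From mathcomp Require Import measurable_realfun ring lra.
Import Order.TTheory GRing.Theory Num.Theory.
Import numFieldNormedType.Exports.
Local Open Scope classical_set_scope.
Local Open Scope ring_scope.
Set Implicit Arguments. Unset Strict Implicit. Unset Printing Implicit Defensive.

(** Let [Q] be the given law on the tight space and [G] its mean measure. The
  factors of the summability condition are [E(V^2) / E(V)] for the beta
  variables, so by independence the condition bounds the [Q]-expectation of
  the energies [sum_{|e| = m} P(A_e)^2 / G(A_e)] (squared L2 norms of the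
  density of [P] relative to [G] on the m-th partition). These increase with
  [m], hence are bounded for [Q]-almost every [P], and by Cauchy-Schwarz a bound
  [n] forces [P(B)^2 <= n G(B)] for all Borel [B]. The set of such [P] is weakly
  compact: limits along an ultrafilter exist for every Borel set, and the
  domination by [G] makes the limit countably additive. The same domination
  shows that on sets of bounded energy the weak topology is generated by the
  countably many maps [P |-> P(A_e)], so weak Borel sets have traces in the
  cylinder sigma-algebra, which is contained in the tight Borel sets. The
  restriction of [Q] to the sets of finite energy therefore defines the weak
  law, which is Radon by regularity on cylinder sets, unique because cylinder
  sets are determined by the projections, and concentrated on [P << G]. *)

(** * Simple approximation, change of law, independence *)

(** [Q] measures tight Borel sets only, and a weakly open set may be an uncountable union of basic
    sets, so [Q] does not extend to weak Borel sets by itself; some countable description of the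
    weak topology has to be found on a set of full measure. The inequality between [P(B)^2] and
    [G(B)] replaces an L2 density because it survives setwise limits and because it bounds the
    remainders of a disjoint series by one null sequence, common to all [P] with the same constant.
    This uniform countable additivity ([add_dominated_tail]) carries both halves of the proof: it
    makes ultrafilter limits countably additive, hence gives compactness, and it lets convergence on
    the tree sets spread to all Borel sets, hence gives the countable description. Neither
    Radon-Nikodym densities nor martingale convergence enter. Integrability of the beta densities is
    not computed either: it is read off from the fact that the prescribed laws have total mass 1. *)

Section simple_approx.
Context d (T : measurableType d) (R : realType).

(** The sum is [g] rounded down to a multiple of [e]; removing its first step replaces [g] by
    [g - e]. *)
Lemma step_sum_approx (e : R) (N : nat) (g : R) : 0 < e -> 0 <= g -> g <= N%:R * e ->
  0 <= g - \sum_(i < N) e * (i.+1%:R * e <= g)%R%:R <= e.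
Proof.
move=> e0; elim: N g => [|N IH] g g0 gN.
  by rewrite big_ord0; rewrite mul0r in gN; lra.
rewrite big_ord_recl /= mul1r; have [eg|eg] := leP e g.
  have := IH (g - e); rewrite subr_ge0 => /(_ eg).
  have -> : g - e <= N%:R * e by move: gN; rewrite -natr1; lra.
  move=> /(_ isT); rewrite mulr1 opprD addrA.
    rewrite (_ : \sum_(i < N) e * (i.+1%:R * e <= g - e)%R%:R =
    \sum_(i < N) e * ((bump 0 i).+1%:R * e <= g)%R%:R)//.
  apply: eq_bigr => i _.
  by rewrite /bump /= add1n -[i.+2%:R]natr1 mulrDl mul1r lerBrDr.
rewrite mulr0 add0r big1 ?subr0 ?g0 ?ltW// => i _.
rewrite /bump /= add1n leNgt (lt_le_trans eg) ?mulr0//.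
by rewrite ler_peMl ?ler1n// ltW.
Qed.

Lemma bounded_simple_approx (f : T -> R) (M e : R) :
  measurable_fun setT f -> (forall x, `|f x| <= M) -> 0 < e ->
  exists (n : nat) (c : nat -> R) (B : nat -> set T),
    (forall i, measurable (B i)) /\
    forall x, `|f x - \sum_(i < n) c i * \1_(B i) x| <= e.
Proof.
move=> mf fM e0.
pose N := (Num.truncn (2 * M / e)).+1.
(* Level 0 is the whole space because [f + M] is nonnegative, so its coefficient [- M] undoes the
   shift; the higher levels form the staircase of [f + M]. *)
exists N.+1, (fun i => if i is 0%N then - M else e).
exists (fun i => [set x | i%:R * e <= f x + M]); split.
  move=> i; rewrite -[X in measurable X]setTI.
  have -> : [set x | i%:R * e <= f x + M] = f @^-1` `[i%:R * e - M, +oo[%classic.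
    by apply/seteqP; split => x /=; rewrite in_itv /= andbT lerBlDr.
  by apply: mf => //; exact: measurable_itv.
move=> x; have := fM x; rewrite ler_norml => /andP[f1 f2].
rewrite big_ord_recl /= indicE mem_set/=; last by rewrite mul0r; lra.
have fN : f x + M <= N%:R * e.
  rewrite (@le_trans _ _ (2 * M))//; first by lra.
  by rewrite -ler_pdivrMr// ltW// truncnS_gt.
have f0 : 0 <= f x + M by lra.
have := step_sum_approx e0 f0 fN.
set S := \sum_(_ < _) _; set S' := \sum_(_ < _) _.
suff -> : S' = S by rewrite ler_norml mulr1; lra.
by apply: eq_bigr => i _; rewrite indicE /= /bump/= add1n; congr (_ * (nat_of_bool _)%:R);
  apply/idP/idP; rewrite inE.
Qed.

Lemma bounded_integrable (P : probability T R) (f : T -> R) (M : R) :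
  measurable_fun setT f -> (forall x, `|f x| <= M) ->
  P.-integrable setT (EFin \o f).
Proof.
move=> mf fM; apply: measurable_bounded_integrable => //.
  by rewrite ltey_eq fin_num_measure.
exists M; split; first by rewrite num_real.
by move=> y My x _ /=; rewrite (le_trans (fM x))// ltW.
Qed.

Lemma Rintegral_simple (P : probability T R) n (c : nat -> R) (B : nat -> set T) :
  (forall i, measurable (B i)) ->
  \int[P]_x (\sum_(i < n) c i * \1_(B i) x) = \sum_(i < n) c i * fine (P (B i)).
Proof.
move=> mB.
have mi i : measurable_fun setT (\1_(B i) : T -> R) by exact: measurable_indic.
have bi i x : `|\1_(B i) x| <= (1:R).
  by rewrite indicE; case: (_ \in _); rewrite ?normr1 ?normr0.
have ic i : P.-integrable setT (EFin \o (fun x => c i * \1_(B i) x)).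
  apply: (@bounded_integrable P _ `|c i|); first exact: measurable_funM.
  by move=> x; rewrite normrM ler_piMr.
elim: n => [|n IH].
  by under eq_Rintegral do rewrite big_ord0; rewrite big_ord0 Rintegral_cst// mul0r.
under eq_Rintegral do rewrite big_ord_recr /=.
rewrite RintegralD//.
  rewrite IH big_ord_recr/= RintegralZl//; last exact: (bounded_integrable P (mi n) (bi n)).
  by rewrite /Rintegral integral_indic// setIT.
apply: (@bounded_integrable P _ (\sum_(i < n) `|c i|)).
  by apply: measurable_sum => i; exact: measurable_funM.
move=> x; rewrite (le_trans (ler_norm_sum _ _ _))//; apply: ler_sum => i _.
by rewrite normrM ler_piMr.
Qed.

(** The approximation is uniform in [x], so one choice of sets and coefficients serves all [P]. This
    reduces convergence of bounded integrals to convergence on finitely many Borel sets. *)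
Lemma Rintegral_simple_approx (f : T -> R) (M e : R) :
  measurable_fun setT f -> (forall x, `|f x| <= M) -> 0 < e ->
  exists (n : nat) (c : nat -> R) (B : nat -> set T),
    (forall i, measurable (B i)) /\
    forall P : probability T R,
      `|\int[P]_x f x - \sum_(i < n) c i * fine (P (B i))| <= e.
Proof.
move=> mf fM e0; have [n [c [B [mB fB]]]] := bounded_simple_approx mf fM e0.
exists n, c, B; split => // P; rewrite -Rintegral_simple//.
have mi : measurable_fun setT (fun x => \sum_(i < n) c i * \1_(B i) x).
  by apply: measurable_sum => i; apply: measurable_funM => //; exact: measurable_indic.
have ig : P.-integrable setT (EFin \o (fun x => \sum_(i < n) c i * \1_(B i) x)).
  apply: (@bounded_integrable P _ (e + M)) => // x.
  have := fB x; have := fM x; rewrite !ler_norml; lra.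
have i_f : P.-integrable setT (EFin \o f) by exact: (bounded_integrable P mf fM).
rewrite -RintegralB//.
apply: (@le_trans _ _ (\int[P]_x e)); last first.
  have PT : P setT = 1%E by exact: probability_setT.
  by rewrite Rintegral_cst// [X in fine X]PT mulr1.
apply: (le_trans (le_normr_Rintegral _ _)) => //.
  by have := integrableB measurableT i_f ig; apply: eq_integrable.
apply: le_Rintegral => //.
- apply: (@bounded_integrable P _ e) => //; last by move=> x; rewrite normr_id.
  by apply: measurableT_comp => //; exact: measurable_funB.
- by apply: (@bounded_integrable P _ e) => // x; rewrite ger0_norm// ltW.
Qed.

End simple_approx.

(** * Change of variables with a density *)

Section change_of_law.
Context d d' (S : measurableType d) (T : measurableType d') (R : realType).
Local Open Scope ereal_scope.
Import HBNNSimple.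

(** The hypothesis makes [nu] the image under [Y] of [mu] weighted by [D]; simple functions and
    monotone convergence do the rest. Used with [D] a product of other variables (independence),
    with [Y] the identity (beta laws) and with [D] constant 1 (projections). *)
Lemma ge0_integral_law (mu : {measure set S -> \bar R})
    (nu : {measure set T -> \bar R}) (Y : S -> T) (D : S -> R) :
  measurable_fun setT Y -> measurable_fun setT D -> (forall x, (0 <= D x)%R) ->
  (forall B, measurable B -> nu B = \int[mu]_(x in Y @^-1` B) (D x)%:E) ->
  forall f : T -> \bar R, measurable_fun setT f -> (forall x, 0 <= f x) ->
  \int[nu]_x f x = \int[mu]_x (f (Y x) * (D x)%:E).
Proof.
move=> mY mD D0 nuE f mf f0.
pose h := nnsfun_approx measurableT mf.
have mYB B : measurable B -> measurable (Y @^-1` B).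
  by move=> mB; rewrite -[X in measurable X]setTI; exact: mY.
have mDE : measurable_fun setT (EFin \o D) by exact/measurable_EFinP.
have -> : \int[nu]_x f x = lim (\int[nu]_x (EFin \o h n) x @[n --> \oo]).
  have fE x : f x = lim ((EFin \o h n) x @[n --> \oo]).
    by apply/esym/cvg_lim => //; exact: cvg_nnsfun_approx.
  under eq_integral => x _ do rewrite fE.
  apply: monotone_convergence => //.
  - by move=> n; apply/measurable_EFinP.
  - by move=> n x _ //=; rewrite lee_fin.
  - by move=> x _ a b ab; rewrite lee_fin; exact/lefP/nd_nnsfun_approx.
have -> : \int[mu]_x (f (Y x) * (D x)%:E) =
    lim (\int[mu]_x ((h n (Y x))%:E * (D x)%:E) @[n --> \oo]).
  have fg x : f (Y x) * (D x)%:E = lim (((h n (Y x))%:E * (D x)%:E) @[n --> \oo]).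
    by apply/esym/cvg_lim => //; apply: cvgeZr => //; exact: cvg_nnsfun_approx.
  under eq_integral => x _ do rewrite fg.
  apply: monotone_convergence => [//| | |].
  - move=> n; apply/emeasurable_funM => //.
    by apply/measurable_EFinP; exact: measurableT_comp.
  - by move=> n x _ /=; rewrite mule_ge0 ?lee_fin.
  - by move=> x _ a b ab/=; rewrite lee_wpmul2r ?lee_fin//; exact/lefP/nd_nnsfun_approx.
apply/congr_lim/funext => n.
have mset r : measurable (h n @^-1` [set r]) by exact: measurable_sfunP.
transitivity (\sum_(y \in range (h n)) (y%:E * nu (h n @^-1` [set y]))).
  under eq_integral do rewrite /= fimfunE -fsumEFin//.
  rewrite ge0_integral_fsum//; last 2 first.
  - by move=> y; exact/measurable_EFinP/measurable_funM.
  - by move=> y x _; rewrite nnfun_muleindic_ge0.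
  by apply: eq_fsbigr => r _; rewrite integralZl_indic_nnsfun// integral_indic//= setIT.
transitivity (\int[mu]_x (\sum_(y \in range (h n))
    (y * \1_(h n @^-1` [set y]) (Y x))%:E * (D x)%:E)); last first.
  apply: eq_integral => x _; rewrite -ge0_mule_fsuml; last first.
    by move=> y; rewrite nnfun_muleindic_ge0.
  by rewrite fsumEFin// -fimfunE.
rewrite ge0_integral_fsum//; last 2 first.
- move=> y; apply: emeasurable_funM => //; apply/measurable_EFinP.
  apply: measurable_funM => //.
  by apply: (@measurableT_comp _ _ _ _ _ _ (\1_(h n @^-1` [set y]) : T -> R)).
- by move=> y x _; rewrite mule_ge0 ?lee_fin// -lee_fin nnfun_muleindic_ge0.
apply: eq_fsbigr => r /[!inE] -[t _ <-].
rewrite nuE//.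
rewrite -ge0_integralZl//; last 4 first.
- exact: mYB.
- exact: measurable_funTS.
- by move=> x _; rewrite lee_fin.
- by rewrite lee_fin.
rewrite integral_mkcond; apply: eq_integral => x _.
rewrite patchE indicE; have -> : (Y x \in h n @^-1` [set h n t]) = (x \in Y @^-1` (h n @^-1` [set h n t])).
  by apply/idP/idP; rewrite !inE.
by case: ifPn => _; rewrite ?mulr1 ?mulr0 ?mul0e.
Qed.

End change_of_law.

(** * Expectations of products of independent variables *)

Section independence.
Context (R : realType) d (Om : measurableType d) (Pr : probability Om R).
Context (I : eqType) (Y : I -> Om -> R).
Hypothesis mY : forall i, measurable_fun setT (Y i).
Hypothesis indep : mutually_independent Pr Y.
Variable (h : I -> R -> R).
Hypothesis mh : forall i, measurable_fun setT (h i).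
Hypothesis h01 : forall i x, 0 <= h i x <= 1.

Lemma prod01 (J : Type) (s : seq J) (F : J -> R) : (forall i, 0 <= F i <= 1) ->
  0 <= \prod_(i <- s) F i <= 1.
Proof.
move=> F01; elim: s => [|i s IH]; first by rewrite big_nil ler01 lexx.
rewrite big_cons; move: IH (F01 i) => /andP[a b] /andP[c e].
by rewrite mulr_ge0//= mulr_ile1.
Qed.

Lemma prod01_bound (J : Type) (s : seq J) (F : J -> R) : (forall i, 0 <= F i <= 1) ->
  `|\prod_(i <- s) F i| <= 1.
Proof. by move=> /(prod01 s)/andP[a b]; rewrite ger0_norm. Qed.

Lemma indic01 (T : Type) (A : set T) x : 0 <= (\1_A x : R) <= 1.
Proof. by rewrite indicE; case: (_ \in _); rewrite ?ler01 ?lexx. Qed.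

(** Independence is given for events only. The induction turns one indicator at a time into a
    function [h i], so the statement has to mix both kinds of factors. *)
Lemma indep_prod_indic (s1 s2 : seq I) (B : I -> set R) :
  uniq (s1 ++ s2) -> (forall i, measurable (B i)) ->
  \int[Pr]_w ((\prod_(i <- s1) h i (Y i w)) * \prod_(i <- s2) \1_(B i) (Y i w)) =
  (\prod_(i <- s1) \int[Pr]_w h i (Y i w)) * \prod_(i <- s2) fine (Pr (Y i @^-1` B i)).
Proof.
have mYB i C : measurable C -> measurable (Y i @^-1` C).
  by move=> mC; rewrite -[X in measurable X]setTI; exact: mY.
have mhY i : measurable_fun setT (fun w => h i (Y i w)) by exact: measurableT_comp.
have hY01 i w : `|h i (Y i w)| <= 1.
  by have /andP[a b] := h01 i (Y i w); rewrite ger0_norm.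
have mind i C : measurable C -> measurable_fun setT (fun w => \1_C (Y i w) : R).
  by move=> mC; apply: measurableT_comp => //; exact: measurable_indic.
elim: s1 s2 B => [|i s1 IH] s2 B us mB.
  rewrite big_nil mul1r -(indep us mB).
  under eq_Rintegral do rewrite big_nil mul1r.
  have <- : \int[Pr]_w (\1_(\bigcap_(i in [set i | i \in s2]) (Y i @^-1` B i)) w) =
     \int[Pr]_w (\prod_(i <- s2) \1_(B i) (Y i w)).
    apply: eq_Rintegral => w _; rewrite indicE.
    have [|] := boolP (_ \in _).
      rewrite inE => wB; rewrite big_seq big1// => i si.
      by rewrite indicE mem_set//; exact: wB.
    rewrite notin_setE => /existsNP[i /not_implyP[/= si nB]].
    by rewrite (big_rem i)//= indicE memNset// mul0r.
  rewrite /Rintegral integral_indic//.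
    by rewrite setIT.
  have -> : \bigcap_(i in [set` s2]) (Y i @^-1` B i) = \big[setI/setT]_(i <- s2) (Y i @^-1` B i).
    elim: (s2) => [|i s IHs]; first by rewrite big_nil; apply/seteqP; split.
    rewrite big_cons -IHs; apply/seteqP; split => w.
      by move=> wi; split => [|j js]; apply: wi; rewrite /= inE ?eqxx ?js ?orbT.
    move=> [wi ws] j; rewrite /= inE => /orP[/eqP->//|js]; exact: ws.
  by apply: bigsetI_measurable => i _; exact: mYB.
set c := (\prod_(i <- s1) \int[Pr]_w h i (Y i w)) * \prod_(i <- s2) fine (Pr (Y i @^-1` B i)).
pose Z w := (\prod_(i <- s1) h i (Y i w)) * \prod_(i <- s2) \1_(B i) (Y i w).
have Z01 w : 0 <= Z w <= 1.
  have /andP[a b] : 0 <= \prod_(i <- s1) h i (Y i w) <= 1 by apply: prod01 => j; exact: h01.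
  have /andP[a' b'] : 0 <= \prod_(i <- s2) (\1_(B i) (Y i w) : R) <= 1.
    by apply: prod01 => j; exact: indic01.
  by rewrite mulr_ge0//= mulr_ile1.
have mZ : measurable_fun setT Z.
  apply: measurable_funM; first by apply: measurable_prod => j ?; exact: mhY.
  by apply: measurable_prod => j ?; exact: mind.
have c0 : 0 <= c.
  apply: mulr_ge0; apply: prodr_ge0 => j _; last exact: fine_ge0.
  by apply: Rintegral_ge0 => w _; have /andP[] := h01 j (Y j w).
(* [Z] collects all factors except the one at [i]. The induction hypothesis, with an indicator of
   [C] added at [i], says that the law of [Y i] weighted by [Z] is [c] times its law; then [h i] can
   be integrated. *)
pose Yp : {mfun Om >-> R} := HB.pack (Y i) (isMeasurableFun.Build _ _ _ _ _ (mY i)).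
pose nu : {measure set R -> \bar R} := mscale (NngNum c0) (distribution Pr Yp).
have [us1 [i1 i2]] : uniq (s1 ++ i :: s2) /\ i \notin s1 /\ i \notin s2.
  move: us; rewrite /= -[s1 ++ i :: s2]/(s1 ++ [:: i] ++ s2) uniq_catCA /=.
  by rewrite mem_cat negb_or => /andP[/andP[-> ->] ->].
have nuE C : measurable C -> (nu C = \int[Pr]_(x in Y i @^-1` C) (Z x)%:E)%E.
  move=> mC; have -> : nu C = (c%:E * Pr (Y i @^-1` C))%E by [].
  pose B' j := if j == i then C else B j.
  have mB' j : measurable (B' j) by rewrite /B'; case: ifP.
  have B'E j : j \in s2 -> B' j = B j.
    by rewrite /B'; case: eqP => // -> ; rewrite (negbTE i2).
  have B'i : B' i = C by rewrite /B' eqxx.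
  have Bs2 : \prod_(j <- s2) fine (Pr (Y j @^-1` B' j)) = \prod_(j <- s2) fine (Pr (Y j @^-1` B j)).
    by apply: eq_big_seq => j js2; rewrite B'E.
  have := IH (i :: s2) B' us1 mB'.
  rewrite [X in _ = _ * X]big_cons B'i mulrCA Bs2 -/c => cE.
  have fP : Pr (Y i @^-1` C) \is a fin_num by exact: fin_num_measure (mYB _ _ mC).
  rewrite -(fineK fP) -EFinM mulrC -cE /Rintegral fineK.
    rewrite [RHS]integral_mkcond; apply: eq_integral => w _.
    rewrite big_cons B'i patchE /Z.
    rewrite indicE; have -> : (Y i w \in C) = (w \in Y i @^-1` C).
      by apply/idP/idP; rewrite !inE.
    case: ifPn => _; last by rewrite mul0r mulr0.
    rewrite mul1r; congr (_ * _)%:E.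
    by apply: eq_big_seq => j js2; rewrite B'E.
  apply: integrable_fin_num => //.
  apply: (@bounded_integrable _ _ _ _ _ 1).
    apply: measurable_funM; first by apply: measurable_prod => j ?; exact: mhY.
    by apply: measurable_prod => j ?; exact: mind.
  move=> w; rewrite normrM mulr_ile1//; apply: prod01_bound => // j.
  exact: indic01.
have := @ge0_integral_law _ _ _ _ _ Pr nu (Y i) Z (mY i) mZ
  (fun w => proj1 (andP (Z01 w))) nuE (EFin \o h i).
have mhE : measurable_fun setT (EFin \o h i) by exact/measurable_EFinP.
move=> /(_ mhE).
have h0 x : (0 <= (EFin \o h i) x)%E by rewrite lee_fin; have /andP[] := h01 i x.
move=> /(_ h0).
rewrite ge0_integral_mscale// ge0_integral_pushforward//.
rewrite preimage_setT => /(congr1 fine) E.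
transitivity (fine (\int[Pr]_x ((EFin \o h i) (Y i x) * (Z x)%:E))).
  by rewrite /Rintegral; congr fine; apply: eq_integral => w _ /=; rewrite big_cons -mulrA.
rewrite -E big_cons -mulrA -/c /Rintegral fineM//=; first by rewrite mulrC.
apply: integrable_fin_num => //.
by apply: (@bounded_integrable _ _ _ _ _ 1) => // w; exact: hY01.
Qed.

Lemma indep_prod (s : seq I) : uniq s ->
  \int[Pr]_w (\prod_(i <- s) h i (Y i w)) = \prod_(i <- s) \int[Pr]_w h i (Y i w).
Proof.
move=> us; have := @indep_prod_indic s [::] (fun=> setT); rewrite cats0.
move=> /(_ us (fun=> measurableT)); rewrite big_nil mulr1 => <-.
by apply: eq_Rintegral => w _; rewrite big_nil mulr1.
Qed.

End independence.

(** * Moments of the beta distribution *)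

Section beta_moments.
Context (R : realType).
Notation mu := (@lebesgue_measure R).
Implicit Types a b x : R.

Lemma beta_dens_ge0 a b x : 0 <= beta_dens a b x.
Proof. by rewrite mulr_ge0// powR_ge0. Qed.

Lemma measurable_beta_dens a b (D : set R) : measurable_fun D (beta_dens a b).
Proof.
apply: measurable_funTS; apply: measurable_funM.
  exact: measurable_powR.
apply: (@measurableT_comp _ _ _ _ _ _ (fun y : R => y `^ (b - 1))); first exact: measurable_powR.
by apply: measurable_funB.
Qed.

Lemma beta_densSl a b x : 0 < a -> x \in `[0, 1] -> beta_dens (a + 1) b x = x * beta_dens a b x.
Proof.
move=> a0; rewrite in_itv/= => /andP[x0 x1].
by rewrite /beta_dens addrK mulrA mulr_powRB1.
Qed.

Lemma beta_densSr a b x : 0 < b -> x \in `[0, 1] ->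
  beta_dens a (b + 1) x = (1 - x) * beta_dens a b x.
Proof.
move=> b0; rewrite in_itv/= => /andP[x0 x1].
by rewrite /beta_dens addrK mulrCA mulr_powRB1// subr_ge0.
Qed.

Definition beta_integrable a b := mu.-integrable `[0, 1] (EFin \o beta_dens a b).

Lemma beta_integrableS a b : 0 < a -> 0 < b -> beta_integrable a b ->
  beta_integrable (a + 1) b /\ beta_integrable a (b + 1).
Proof.
move=> a0 b0 iab; split; apply: (le_integrable _ _ _ iab) => //.
- by apply/measurable_EFinP; exact: measurable_beta_dens.
- move=> x /= x01; rewrite lee_fin beta_densSl//.
  rewrite normrM ler_piMl//; move: x01; rewrite in_itv/= => /andP[x0 x1].
  by rewrite ger0_norm.
- by apply/measurable_EFinP; exact: measurable_beta_dens.
- move=> x /= x01; rewrite lee_fin beta_densSr//.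
  rewrite normrM ler_piMl//; move: x01; rewrite in_itv/= => /andP[x0 x1].
  by rewrite ger0_norm; lra.
Qed.

Lemma beta_const_split a b : 0 < a -> 0 < b -> beta_integrable a b ->
  beta_const a b = beta_const (a + 1) b + beta_const a (b + 1).
Proof.
move=> a0 b0 iab; have [i1 i2] := beta_integrableS a0 b0 iab.
rewrite /beta_const -RintegralD//; apply: eq_Rintegral => x; rewrite inE/= => x01.
by rewrite beta_densSl// beta_densSr// -mulrDl addrC subrK mul1r.
Qed.

(** [f] is the derivative of [F] on the open unit interval, written with beta densities of shifted
    parameters. *)
Let F a b x := x `^ a * (1 - x) `^ b.
Let f a b x := a * beta_dens a (b + 1) x - b * beta_dens (a + 1) b x.

Lemma is_derive_beta a b x : 0 < x < 1 -> is_derive x 1 (F a b) (f a b x).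
Proof.
move=> /andP[x0 x1].
have h1 : is_derive x 1 (fun y : R => y `^ a) (a * x `^ (a - 1)) by exact: is_derive1_powR.
have h2 : is_derive x 1 (fun y => 1 - y) (-1 : R).
  by rewrite -[X in is_derive _ _ _ X]sub0r; exact: is_deriveB.
have x1' : 0 < 1 - x by rewrite subr_gt0.
have h3 : is_derive x 1 (fun y => (1 - y) `^ b) (b * (1 - x) `^ (b - 1) * -1) :=
  @is_derive1_comp R (fun y : R => y `^ b) (fun y => 1 - y) x _ _ (is_derive1_powR b x1') h2.
apply: is_derive_eq.
rewrite /f /beta_dens !addrK /GRing.scale/=; ring.
Qed.

Lemma beta_FTC a b u v : 0 < u -> u < v -> v < 1 ->
  (\int[mu]_(x in `[u, v]) (f a b x)%:E = (F a b v)%:E - (F a b u)%:E)%E.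
Proof.
move=> u0 uv v1.
have cF x : 0 < x < 1 -> {for x, continuous (F a b)}.
  by move=> /(is_derive_beta a b)[d _]; exact/differentiable_continuous/derivable1_diffP.
apply: continuous_FTC2 => //.
- apply: derivable_within_continuous => x; rewrite in_itv/= => /andP[ux xv].
  have x01 : 0 < x < 1 by apply/andP; split; lra.
  have d1 c e : derivable (beta_dens c e) x 1.
    have /andP[x0 x1] := x01.
    have h1 : is_derive x 1 (fun y : R => y `^ (c - 1)) _ := is_derive1_powR (c - 1) x0.
    have h2 : is_derive x 1 (fun y => 1 - y) (-1 : R).
      by rewrite -[X in is_derive _ _ _ X]sub0r; exact: is_deriveB.
    have x1' : 0 < 1 - x by rewrite subr_gt0.
    have h3 : is_derive x 1 (fun y => (1 - y) `^ (e - 1)) ((e - 1) * (1 - x) `^ (e - 1 - 1) * -1) :=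
      @is_derive1_comp R (fun y : R => y `^ (e - 1)) (fun y => 1 - y) x _ _ (is_derive1_powR (e - 1) x1') h2.
    exact: ex_derive.
  by apply: derivableB; apply: derivableM => //; exact: derivable_cst.
- split.
  + move=> x; rewrite in_itv/= => /andP[ux xv].
    by apply: ex_derive; apply: is_derive_beta; apply/andP; split; lra.
  + by apply: cvg_at_right_filter; apply: cF; apply/andP; split; lra.
  + by apply: cvg_at_left_filter; apply: cF; apply/andP; split; lra.
- move=> x; rewrite in_itv/= => /andP[ux xv].
  have x01 : 0 < x < 1 by apply/andP; split; lra.
  by rewrite derive1E; have [_ ->] := is_derive_beta a b x01.
Qed.

(** Integration by parts: [F a b] tends to 0 at both ends of the unit interval, so its derivative
    [f a b] integrates to 0. *)
Lemma beta_const_sym_rec a b : 0 < a -> 0 < b -> beta_integrable a b ->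
  a * beta_const a (b + 1) = b * beta_const (a + 1) b.
Proof.
move=> a0 b0 iab; have [i1 i2] := beta_integrableS a0 b0 iab.
apply/eqP; rewrite -subr_eq0 /beta_const -!RintegralZl// -RintegralB//; last 2 first.
- by have : mu.-integrable `[0, 1] (fun x => a%:E * (EFin \o beta_dens a (b + 1)) x)%E by exact: integrableZl.
- by have : mu.-integrable `[0, 1] (fun x => b%:E * (EFin \o beta_dens (a + 1) b) x)%E by exact: integrableZl.
have iif : mu.-integrable `[0, 1] (EFin \o f a b).
  have j2 : mu.-integrable `[0, 1] (fun x => a%:E * (EFin \o beta_dens a (b + 1)) x)%E by exact: integrableZl.
  have j1 : mu.-integrable `[0, 1] (fun x => b%:E * (EFin \o beta_dens (a + 1) b) x)%E by exact: integrableZl.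
  by have := integrableB _ j2 j1; apply.
have ioo : mu.-integrable `]0, 1[ (EFin \o f a b).
  by apply: integrableS iif => //; exact: subset_itv_oo_cc.
have mf D : measurable_fun D (f a b).
  by apply: measurable_funB; apply: measurable_funM => //; exact: measurable_beta_dens.
(* Starting at one third keeps [u n] below [1 - u n]. *)
pose u (n : nat) : R := n.+3%:R^-1.
have u0 n : 0 < u n by rewrite invr_gt0.
have u1 n : u n < 1 - u n.
  have : u n <= 3^-1 by rewrite lef_pV2 ?posrE// ler_nat.
  lra.
have u1' n : 1 - u n < 1 by rewrite ltrBlDr ltrDl.
have ucv : u @ \oo --> (0 : R).
  have := @cvg_harmonic R; rewrite -(cvg_shiftn 2) => h.
  by apply: cvg_trans h; apply: near_eq_cvg; apply: nearW => n /=; rewrite /u addn2.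
have ucvr : u @ \oo --> (0 : R)^'+.
  move=> A hA; apply: (@filterS _ \oo _ (u @^-1` (fun y => 0 < y -> A y))).
    by move=> n un; exact: un (u0 n).
  exact: ucv hA.
have pcv (c : R) : 0 < c -> (fun n => u n `^ c) @ \oo --> (0 : R).
  by move=> c0; apply: (@cvg_comp _ _ _ u (fun a => a `^ c) _ _ _ ucvr); exact: powR_cvg0.
have Ffu : (fun n => F a b (1 - u n) - F a b (u n)) @ \oo --> (0 : R).
  rewrite -[X in _ --> X](subr0 0); apply: cvgB.
    apply: (@squeeze_cvgr _ _ _ _ (cst 0) (fun n => u n `^ b)) => //; last 2 first.
      exact: cvg_cst.
      exact: pcv.
    apply: nearW => n; rewrite /F subKr mulr_ge0 ?powR_ge0//= ler_piMl ?powR_ge0//.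
    suff : (1 - u n) `^ a <= 1 `^ a by rewrite powR1.
  have un1 := u1 n; have un0 := u0 n.
  by apply: ge0_ler_powR; rewrite ?nnegrE; lra.
  apply: (@squeeze_cvgr _ _ _ _ (cst 0) (fun n => u n `^ a)) => //; last 2 first.
    exact: cvg_cst.
    exact: pcv.
  apply: nearW => n; rewrite /F mulr_ge0 ?powR_ge0//= ler_piMr ?powR_ge0//.
  suff : (1 - u n) `^ b <= 1 `^ b by rewrite powR1.
  have un1 := u1 n; have un0 := u0 n.
  by apply: ge0_ler_powR; rewrite ?nnegrE; lra.
(* [f a b] may be unbounded near 0 and 1, so the fundamental theorem is applied on truncated
   intervals and the limit is dominated by the absolute value of [f a b]. *)
pose fn n := (EFin \o f a b) \_ (`[u n, 1 - u n]%classic : set R).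
have := @dominated_convergence _ _ _ mu `]0, 1[%classic _ fn (EFin \o f a b)
  (abse \o (EFin \o f a b)).
case.
- exact: measurable_itv.
- move=> n; apply/measurable_restrict => //; apply/measurable_EFinP; exact: mf.
- by apply/measurable_EFinP; exact: mf.
- apply: aeW => x /=; rewrite in_itv/= => /andP[x0 x1].
  apply: cvg_near_cst.
  have : \forall n \near \oo, u n < Num.min x (1 - x).
    by apply: (cvgr_lt _ ucv); rewrite lt_min x0 subr_gt0.
  apply: filterS => n; rewrite lt_min => /andP[ux u1x].
  rewrite /fn patchE mem_set//= in_itv/=; apply/andP; split; lra.
- exact: integrable_abse.
- apply: aeW => x n _; rewrite /fn patchE; case: ifP => //=.
  by move=> _; rewrite lee_fin normr0.
move=> _ _ cvf.
have E n : (\int[mu]_(x in `]0%R, 1%R[) fn n x = (F a b (1 - u n) - F a b (u n))%:E)%E.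
  rewrite EFinB -beta_FTC// /fn -integral_mkcondr; congr integral.
  apply/seteqP; split => x /=; first by move=> [].
  move=> xu; split => //; move: xu; rewrite !in_itv/= => /andP[ux xu].
  by have := u0 n; have := u1' n; move=> *; apply/andP; split; lra.
have cvE : ((fun n => (F a b (1 - u n) - F a b (u n))%:E) @ \oo -->
   (\int[mu]_(x in `]0%R, 1%R[) (f a b x)%:E))%E.
  by apply: cvg_trans cvf; apply: near_eq_cvg; apply: nearW => n /=; rewrite E.
have cv0 : ((fun n => (F a b (1 - u n) - F a b (u n))%:E) @ \oo --> 0%:E)%E.
  by apply: cvg_EFin => //; exact: nearW.
have I0 := cvg_unique _ cvE cv0.
rewrite -Rintegral_itv_obnd_cbnd; last first.
  by apply: integrableS iif => //; apply: subset_itvr; rewrite bnd_simp.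
rewrite -Rintegral_itv_bndo_bndc//.
by rewrite /Rintegral I0.
Qed.

(** The splitting [x + (1 - x) = 1] and the integration by parts are two linear equations for the
    two shifted constants. *)
Lemma beta_constS a b : 0 < a -> 0 < b -> beta_integrable a b ->
  beta_const (a + 1) b = a / (a + b) * beta_const a b /\
  beta_const a (b + 1) = b / (a + b) * beta_const a b.
Proof.
move=> a0 b0 iab; have := beta_const_sym_rec a0 b0 iab.
rewrite (beta_const_split a0 b0 iab); set p := beta_const (a + 1) b.
set q := beta_const a (b + 1) => E.
have ab0 : a + b != 0 by rewrite gt_eqF// addr_gt0.
split; apply: (mulfI ab0); rewrite mulrA [(a + b) * (_ / _)]mulrCA divff// mulr1; lra.
Qed.

End beta_moments.

(** * Set functions dominated by a probability *)

Section probability_values.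
Context d (T : measurableType d) (R : realType).
Implicit Types (P : probability T R) (B C : set T).

Definition pr P B : R := fine (P B).

Lemma prE P B : measurable B -> P B = (pr P B)%:E.
Proof. by move=> mB; rewrite /pr fineK// fin_num_measure. Qed.

Lemma pr_ge0 P B : 0 <= pr P B.
Proof. exact: fine_ge0. Qed.

Lemma prT P : pr P setT = 1.
Proof. by have PT : (P setT = 1)%E := probability_setT P; rewrite /pr PT. Qed.

Lemma pr0 P : pr P set0 = 0.
Proof. by rewrite /pr measure0. Qed.

Lemma prU P B C : measurable B -> measurable C -> B `&` C = set0 ->
  pr P (B `|` C) = pr P B + pr P C.
Proof.
move=> mB mC BC; have : (P (B `|` C) = P B + P C)%E := measureU P mB mC BC.
by rewrite !prE//; [move=> -[]|exact: measurableU].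
Qed.

Lemma le_pr P B C : measurable B -> measurable C -> B `<=` C -> pr P B <= pr P C.
Proof. by move=> mB mC BC; rewrite -lee_fin -!prE//; apply: le_measure => //; rewrite inE. Qed.

Lemma pr_le1 P B : measurable B -> pr P B <= 1.
Proof. by move=> mB; rewrite -(prT P) le_pr. Qed.

Lemma pr_setC P B : measurable B -> pr P (~` B) = 1 - pr P B.
Proof.
move=> mB; have := prU P mB (measurableC mB) (setICr B).
by rewrite setUv prT => ->; rewrite addrC addKr.
Qed.

Lemma pr_bigsetU P (F : nat -> set T) n : (forall i, measurable (F i)) ->
  trivIset setT F -> pr P (\big[setU/set0]_(i < n) F i) = \sum_(i < n) pr P (F i).
Proof.
move=> mF tF; elim: n => [|n IH]; first by rewrite !big_ord0 pr0.
rewrite !big_ord_recr/= prU ?IH//; first exact: bigsetU_measurable.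
apply/seteqP; split => // x [+ Fn]; rewrite -bigcup_mkord => -[i /= ni Fi].
have : F i `&` F n = set0 by move/trivIsetP : tF; apply => //; rewrite neq_ltn ni.
by move/seteqP => [/(_ x) h _]; exact: (h (conj Fi Fn)).
Qed.

Lemma pr_bigcup_cvg P (F : nat -> set T) : (forall i, measurable (F i)) ->
  trivIset setT F -> (fun n => \sum_(i < n) pr P (F i)) @ \oo --> pr P (\bigcup_i F i).
Proof.
move=> mF tF; have mU : measurable (\bigcup_i F i) by exact: bigcupT_measurable.
have : (\sum_(0 <= i < n) P (F i) @[n --> \oo] --> P (\bigcup_i F i))%E.
  exact: measure_semi_sigma_additive.
rewrite prE// => /fine_cvg/=; apply: cvg_trans; apply: near_eq_cvg; apply: nearW => n.
transitivity (fine (\sum_(i < n) (pr P (F i))%:E)%E); last by rewrite sumEFin.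
by rewrite /= big_mkord; congr fine; apply: eq_bigr => i _; rewrite prE.
Qed.

End probability_values.

Section dominated_probabilities.
Context d (T : measurableType d) (R : realType) (G : probability T R) (c : R).

(** What Cauchy-Schwarz gives for a density relative to [G] of squared L2 norm at most [c], phrased
    without the density so that it is stable under setwise limits. *)
Definition quad_dominated : set (probability T R) :=
  [set P | forall B, measurable B -> pr P B ^+ 2 <= c * pr G B].

(** Plain set functions, constrained on measurable sets only: the level approximations of a
    probability are then covered without being packed as measures. *)
Definition add_dominated : set (set T -> R) :=
  [set phi | [/\ phi setT = 1, forall B, measurable B -> 0 <= phi B,
     forall B C, measurable B -> measurable C -> B `&` C = set0 ->
       phi (B `|` C) = phi B + phi C &
     forall B, measurable B -> phi B ^+ 2 <= c * pr G B]].

Lemma quad_dominated_add P : quad_dominated P -> add_dominated (pr P).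
Proof.
by move=> KP; split => //; [exact: prT|move=> B _; exact: pr_ge0|exact: prU].
Qed.

Lemma add_dominated0 phi : add_dominated phi -> phi set0 = 0.
Proof.
move=> [_ _ add _]; have := add _ _ measurable0 measurable0 (set0I set0).
by rewrite setU0 => /eqP; rewrite -subr_eq subrr eq_sym => /eqP.
Qed.

Lemma add_dominatedC phi B : add_dominated phi -> measurable B -> phi (~` B) = 1 - phi B.
Proof.
move=> [p1 _ add _] mB; have := add _ _ mB (measurableC mB) (setICr B).
by rewrite setUv p1 => ->; rewrite addrC addKr.
Qed.

Lemma add_dominated_bigsetU phi (F : nat -> set T) n : add_dominated phi ->
  (forall i, measurable (F i)) -> trivIset setT F ->
  phi (\big[setU/set0]_(i < n) F i) = \sum_(i < n) phi (F i).
Proof.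
move=> Kphi mF tF; have [_ _ add _] := Kphi.
elim: n => [|n IH]; first by rewrite !big_ord0 add_dominated0.
rewrite !big_ord_recr/= add ?IH//; first exact: bigsetU_measurable.
apply/seteqP; split => // x [+ Fn]; rewrite -bigcup_mkord => -[i /= ni Fi].
have : F i `&` F n = set0 by move/trivIsetP : tF; apply => //; rewrite neq_ltn ni.
by move/seteqP => [/(_ x) h _]; exact: (h (conj Fi Fn)).
Qed.

(** Uniform countable additivity: the remainder of the series is the value on the tail set, at most
    the square root of [c] times its [G]-mass, and this bound does not involve [phi]. *)
Lemma add_dominated_tail (F : nat -> set T) : (forall i, measurable (F i)) ->
  trivIset setT F ->
  exists e : nat -> R, e @ \oo --> (0 : R) /\ forall phi n, add_dominated phi ->
    `|phi (\bigcup_i F i) - \sum_(i < n) phi (F i)| <= e n.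
Proof.
move=> mF tF; have mU : measurable (\bigcup_i F i) by exact: bigcupT_measurable.
pose t n := pr G (\bigcup_i F i) - \sum_(i < n) pr G (F i).
pose D n := \bigcup_i F i `\` \big[setU/set0]_(i < n) F i.
have mb n : measurable (\big[setU/set0]_(i < n) F i) by exact: bigsetU_measurable.
have mD n : measurable (D n) by exact: measurableD.
have sub n : \big[setU/set0]_(i < n) F i `<=` \bigcup_i F i.
  by rewrite -bigcup_mkord => x [i _ Fx]; exists i.
have UE n : \bigcup_i F i = \big[setU/set0]_(i < n) F i `|` D n by rewrite setDUK.
have UD n : \big[setU/set0]_(i < n) F i `&` D n = set0 by rewrite setDIK.
have tE n : pr G (D n) = t n.
  by rewrite /t -pr_bigsetU// [in RHS](UE n) prU// addrC addKr.
exists (fun n => Num.sqrt (c * t n)); split.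
  rewrite -(sqrtr0 R); apply: continuous_cvg; first exact: sqrt_continuous.
  rewrite -(mulr0 c); apply: cvgMr.
  rewrite -(subrr (pr G (\bigcup_i F i))); apply: cvgB; first exact: cvg_cst.
  exact: pr_bigcup_cvg.
move=> phi n Kphi; have [_ phi0 add dom] := Kphi.
have -> : phi (\bigcup_i F i) - \sum_(i < n) phi (F i) = phi (D n).
  by rewrite -(add_dominated_bigsetU n Kphi mF tF) [in LHS](UE n) add// addrC addKr.
by rewrite -sqrtr_sqr ler_wsqrtr// -tE; exact: dom.
Qed.

End dominated_probabilities.

Lemma cvg_sumr (R : realType) (T : Type) (F : set_system T) (FF : Filter F) n
    (f : nat -> T -> R) (l : nat -> R) :
  (forall i, (i < n)%N -> f i x @[x --> F] --> l i) ->
  \sum_(i < n) f i x @[x --> F] --> \sum_(i < n) l i.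
Proof.
elim: n => [|n IH] fl.
  by rewrite big_ord0; under eq_fun do rewrite big_ord0; exact: cvg_cst.
rewrite big_ord_recr/=; under eq_fun do rewrite big_ord_recr/=.
by apply: cvgD; [apply: IH => i ni; exact/fl/ltnW|exact: fl].
Qed.

(** * Setwise convergence and limits along ultrafilters *)

Section weak_topology.
Context (R : realType) (X : pseudoPMetricType R).
Local Notation M := (M1 X).
Local Notation BX := (borelType X).
Implicit Types (P Q : M) (B : set BX) (W : set M).

Lemma cvg_Rintegral_bounded (F : set_system M) (FF : Filter F) (P0 : M) (f : BX -> R) (C : R) :
  (forall B : set BX, measurable B -> pr P B @[P --> F] --> pr P0 B) ->
  measurable_fun setT f -> (forall x, `|f x| <= C) ->
  (\int[P]_x f x) @[P --> F] --> \int[P0]_x f x.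
Proof.
move=> FP mf fC; apply/cvgrPdist_lt => e e0.
have e3 : 0 < e / 3 by rewrite divr_gt0.
have [n [c [B [mB fB]]]] := Rintegral_simple_approx mf fC e3.
have cS : (\sum_(i < n) c i * pr P (B i)) @[P --> F] --> \sum_(i < n) c i * pr P0 (B i).
  by apply: (@cvg_sumr _ _ _ FF n (fun i P => c i * pr P (B i)) (fun i => c i * pr P0 (B i))) => i _; apply: cvgMr; exact: FP.
move/cvgrPdist_lt : cS => /(_ _ e3); apply: filterS => P.
have := fB P; have := fB P0; rewrite /pr.
by rewrite !ler_norml !ltr_norml; lra.
Qed.

(** A basic weak neighbourhood is cut out by finitely many bounded integrals, and each of these
    converges. Filters on the bare type [M] stand in for a topological structure. *)
Lemma weak_open_nbhs (F : set_system M) (FF : Filter F) (P0 : M) W :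
  (forall B : set BX, measurable B -> pr P B @[P --> F] --> pr P0 B) ->
  @weak_open R X W -> W P0 -> F W.
Proof.
move=> FP WO WP0; have [n [Fi [FiS FiW]]] := WO _ WP0.
have h i : (i < n)%N -> F (Fi i).
  move=> ni; have [[f [V [mf [[C fC] [oV FiE]]]]] _] := FiS i ni.
  rewrite FiE; have := cvg_Rintegral_bounded FF FP mf fC; apply.
  by apply: open_nbhs_nbhs; split => //; move: (FiS i ni) => [] _; rewrite FiE.
have : F (\bigcap_(i in [set: 'I_n]) Fi (val i)).
  apply: filterS (filter_forall _ (fun i : 'I_n => h i (ltn_ord i))).
  by move=> P PF i _; exact: PF.
apply: filterS => P PF; apply: FiW => i ni; exact: (PF (Ordinal ni)).
Qed.

(** Compactness of the unit interval gives a cluster point, and along an ultrafilter a cluster point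
    is a limit. *)
Lemma ultra_cvg01 (T : Type) (U : set_system T) (UU : UltraFilter U) (g : T -> R) :
  (forall x, 0 <= g x <= 1) -> exists l : R, 0 <= l /\ g x @[x --> U] --> l.
Proof.
move=> g01; have UP : ProperFilter U := @ultra_proper _ U UU.
have [l [l01 cl]] : `[0%R, 1%R] `&` cluster (g @ U) !=set0.
  apply: (@segment_compact R 0 1).
  have gU : U (g @^-1` `[0%R, 1%R]).
    by apply: filterS (filterT : U setT) => x _; rewrite /= in_itv/= g01.
  exact: gU.
exists l; split; first by move: l01; rewrite /= in_itv/= => /andP[].
move=> N Nl; have [//|UN] := in_ultra_setVsetC (g @^-1` N) UU.
by have [y [/= Ny]] := cl _ _ (UN : (g @ U) (~` N)) Nl.
Qed.

Variables (G : probability BX R) (c : R).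

Lemma ultra_dominated_limit (U : set_system M) (UU : UltraFilter U) :
  U (quad_dominated G c) -> exists2 P0 : M, quad_dominated G c P0 &
    forall B : set BX, measurable B -> pr P B @[P --> U] --> pr P0 B.
Proof.
move=> UK.
have ex (B : set BX) : exists l : R, 0 <= l /\ (measurable B -> pr P B @[P --> U] --> l).
  (* The limit measure is a function on all sets; nonmeasurable ones receive the value 0. *)
  have [mB|nB] := pselect (measurable B); last by exists 0; split.
  have [|l [l0 cl]] := @ultra_cvg01 _ U UU (fun P : M => pr P B).
    by move=> P; rewrite pr_ge0 pr_le1.
  by exists l.
have [L LP] := choice ex.
have cvL B : measurable B -> pr P B @[P --> U] --> L B by move=> mB; exact: (LP B).2.
have L0 B : 0 <= L B by exact: (LP B).1.
have uniqL B (l : R) : measurable B -> pr P B @[P --> U] --> l -> L B = l.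
  by move=> mB; apply: cvg_unique (cvL _ mB).
have Le : L set0 = 0.
  by apply: uniqL => //; under eq_fun do rewrite pr0; exact: cvg_cst.
have LT : L setT = 1.
  by apply: uniqL => //; under eq_fun do rewrite prT; exact: cvg_cst.
pose mu (B : set BX) : \bar R := (L B)%:E.
have mu0 : mu set0 = 0%E by rewrite /mu Le.
have mu_ge0 B : (0 <= mu B)%E by rewrite lee_fin.
have muS : semi_sigma_additive mu.
  move=> F mF tF mU; have [e [e0 eP]] := add_dominated_tail G c mF tF.
  apply: (@cvg_trans _ ((fun n => (\sum_(i < n) L (F i))%:E) @ \oo)).
    by apply: near_eq_cvg; apply: nearW => n; rewrite big_mkord sumEFin.
  apply: cvg_EFin; first exact: nearW.
  apply/cvgrPdist_le => eps eps0; move/cvgrPdist_le : (e0) => /(_ _ eps0).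
  apply: filterS => n; rewrite sub0r normrN => en.
  (* For fixed [n] the tail bound [e n] holds for all [P] in the dominated set, so it passes to the
     limit along [U]; only afterwards does [n] grow. *)
  have cn : `|pr P (\bigcup_i F i) - \sum_(i < n) pr P (F i)| @[P --> U] -->
      `|L (\bigcup_i F i) - \sum_(i < n) L (F i)|.
    apply: cvg_norm; apply: cvgB; first exact: cvL.
    by apply: (@cvg_sumr _ _ _ _ n (fun i P => pr P (F i)) (fun i => L (F i))) => i _; exact: cvL.
  apply: (le_trans _ (le_trans (ler_norm _) en)).
  by apply: (cvgr_to_le cn); apply: filterS UK => P PK; exact/eP/quad_dominated_add.
pose muM := isMeasure.Build _ _ _ mu mu0 mu_ge0 muS.
pose P1 : {measure set BX -> \bar R} := HB.pack mu muM.
have PT1 : P1 setT = 1%E by rewrite /= /mu LT.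
pose P2 : probability BX R := HB.pack (Measure.sort P1) (Measure_isProbability.Build _ _ _ (Measure.sort P1) PT1).
exists P2; last by move=> B mB; exact: cvL.
move=> B mB; rewrite -[pr P2 B]/(L B).
have cL : pr P B ^+ 2 @[P --> U] --> L B ^+ 2.
  by rewrite expr2; under eq_fun do rewrite expr2; apply: cvgM; exact: cvL.
by apply: (cvgr_to_le cL); apply: filterS UK => P; exact.
Qed.
End weak_topology.

(** * The weak topology *)

Lemma seq_of_family (T : Type) n (F : nat -> T) :
  exists s : seq T, forall x, List.In x s <-> exists2 i, (i < n)%N & x = F i.
Proof.
elim: n => [|n [s sP]]; first by exists [::] => x; split => [[]|[]].
exists (F n :: s) => x; split => [[<-|/sP[i ni ->]]|[i]].
- by exists n.
- by exists i => //; rewrite ltnS ltnW.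
- rewrite ltnS leq_eqVlt => /orP[/eqP-> ->|ni ->]; first by left.
  by right; apply/sP; exists i.
Qed.

Lemma family_of_seq (T : Type) (x0 : T) (s : seq T) :
  exists F : nat -> T, forall x, List.In x s <-> exists2 i, (i < size s)%N & x = F i.
Proof.
elim: s => [|y s [F FP]]; first by exists (fun=> x0) => x; split => [[]|[]].
exists (fun i => if i is j.+1 then F j else y) => x; split => [[<-|/FP[i ni ->]]|[[_ ->|i]]].
- by exists 0%N.
- by exists i.+1.
- by left.
- by rewrite /= ltnS => ni ->; right; apply/FP; exists i.
Qed.

(** Lists can be concatenated and filtered, as the compactness arguments require; [List.In] is used
    because [T] carries no boolean equality. *)
Lemma gen_compact_seq (T : Type) (O : set (set T)) (K : set T) :
  gen_compact O K <-> forall Cs : set (set T), Cs `<=` O -> K `<=` \bigcup_(C in Cs) C ->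
    exists s : seq (set T), (forall C, List.In C s -> Cs C) /\
      forall x, K x -> exists2 C, List.In C s & C x.
Proof.
split => h Cs CsO Kc; have := h Cs CsO Kc.
  move=> [n [F [FC KF]]]; have [s sP] := seq_of_family n F; exists s; split.
    by move=> C /sP[i ni ->]; exact: FC.
  by move=> x /KF[i /= ni Fx]; exists (F i) => //; apply/sP; exists i.
move=> [s [sC sK]]; have [F FP] := family_of_seq set0 s; exists (size s), F; split.
  by move=> i ni; apply/sC/FP; exists i.
by move=> x /sK[C /FP[i ni ->] Fx]; exists i.
Qed.

Section weak_open_lemmas.
Context (R : realType) (X : pseudoPMetricType R).
Local Notation M := (M1 X).
Local Notation BX := (borelType X).
Implicit Types (P Q : M) (B : set BX) (W : set M).

Lemma weak_open_local W :
  (forall P, W P -> exists W', [/\ weak_open W', W' P & W' `<=` W]) -> weak_open W.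
Proof.
move=> h P WP; have [W' [oW' W'P sW]] := h P WP.
have [n [F [FS FW]]] := oW' P W'P.
by exists n, F; split => // y yF; exact/sW/FW.
Qed.

Lemma weak_openT : weak_open [set: M].
Proof. by move=> P _; exists 0%N, (fun=> setT). Qed.

Lemma weak_openI W W' : weak_open W -> weak_open W' -> weak_open (W `&` W').
Proof.
move=> oW oW' P [WP W'P].
have [n [F [FS FW]]] := oW P WP; have [n' [F' [FS' FW']]] := oW' P W'P.
exists (n + n')%N, (fun i => if (i < n)%N then F i else F' (i - n)%N); split.
  move=> i ini; case: ltnP => ni; first exact: FS.
  by apply: FS'; rewrite ltn_subLR.
move=> Q QF; split; first by apply: FW => i ni; have := QF i; rewrite ni ltn_addr//; exact.
apply: FW' => i ni; have := QF (n + i)%N.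
by rewrite ltn_add2l ni ltnNge leq_addr/= addKn; exact.
Qed.

Lemma weak_open_bigcup (I : Type) (D : set I) (W : I -> set M) :
  (forall i, D i -> weak_open (W i)) -> weak_open (\bigcup_(i in D) W i).
Proof.
move=> oW; apply: weak_open_local => P [i Di WiP].
by exists (W i); split => //; [exact: oW|move=> Q ?; exists i].
Qed.

Lemma Rintegral_indic_pr P B : measurable B -> \int[P]_x (\1_B x) = pr P B.
Proof. by move=> mB; rewrite /Rintegral integral_indic// setIT. Qed.

Lemma weak_open_pr B (V : set R) : measurable B -> open V ->
  weak_open [set P : M | V (pr P B)].
Proof.
move=> mB oV P VP; exists 1%N, (fun=> [set P : M | V (pr P B)]); split => [i _|Q /(_ 0%N)]; last exact.
split => //; exists (\1_B), V; split; first exact: measurable_indic.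
split; first by exists 1 => x; rewrite indicE; case: (_ \in _); rewrite ?normr1 ?normr0.
by split => //; apply/seteqP; split => Q /=; rewrite Rintegral_indic_pr.
Qed.

Lemma weak_closedU W W' : weak_open (~` W) -> weak_open (~` W') -> weak_open (~` (W `|` W')).
Proof. by rewrite setCU; exact: weak_openI. Qed.

Lemma gen_compact_closed (K W : set M) : gen_compact (@weak_open R X) K ->
  weak_open (~` W) -> W `<=` K -> gen_compact (@weak_open R X) W.
Proof.
move=> /gen_compact_seq cK cW WK; apply/gen_compact_seq => Cs CsO Wc.
have [||s [sCs sK]] := cK (Cs `|` [set ~` W]).
- by move=> C [/CsO//|->].
- move=> P KP; have [WP|nWP] := pselect (W P); last by exists (~` W) => //; right.
  by have [C CsC CP] := Wc P WP; exists C => //; left.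
exists (List.filter (fun C => `[< Cs C >]) s); split.
  by move=> C /List.filter_In[_ /asboolP].
move=> P WP; have [C Cs' CP] := sK P (WK _ WP); exists C => //.
apply/List.filter_In; split => //; apply/asboolP.
by have [//|CW] := sCs C Cs'; move: CP; rewrite CW.
Qed.

Variables (G : probability BX R) (c : R).

(** Without a finite subcover, the parts of the set missed by finite subfamilies generate a proper
    filter. An ultrafilter above it has a limit in the set, and the member of the cover containing
    this limit belongs to the ultrafilter together with its complement in the set. *)
Lemma quad_dominated_compact : gen_compact (@weak_open R X) (quad_dominated G c).
Proof.
apply/gen_compact_seq => Cs CsO Kcov; apply: contrapT => nfin.
pose D := [set s : seq (set M) | forall C, List.In C s -> Cs C].
pose Fs (s : seq (set M)) := (quad_dominated G c : set M) `&` [set P | forall C, List.In C s -> ~ C P].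
have D0 : D [::] by [].
have PF : ProperFilter (filter_from D Fs).
  apply: filter_from_proper.
    apply: filter_from_filter; first by exists [::].
    move=> s1 s2 D1 D2; exists (s1 ++ s2).
      by move=> C /List.in_app_iff[]; [exact: D1|exact: D2].
    move=> P [KP h]; split; split => // C Cs'; apply: h; apply/List.in_app_iff; [left|right]; done.
  move=> s Ds; apply: contrapT => h; apply: nfin; exists s; split => // P KP.
  apply: contrapT => nC; apply: h; exists P; split => // C Cs' CP.
  by apply: nC; exists C.
have [U [UU sU]] := ultraFilterLemma PF.
have UP : ProperFilter U := @ultra_proper _ U UU.
have UK : U (quad_dominated G c) by apply: sU; exists [::] => // P [].
have [P0 KP0 cP0] := ultra_dominated_limit UU UK.
have [C CsC CP0] := Kcov P0 KP0.
have UC : U C by apply: (weak_open_nbhs _ cP0) => //; exact: CsO.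
have UnC : U (Fs [:: C]).
  by apply: sU; exists [:: C] => // C' [<-|].
have [P [CP [_ nCP]]] := filter_ex (filterI UC UnC).
by apply: (nCP C) => //; left.
Qed.

End weak_open_lemmas.

(** * From tree sets to all Borel sets *)

Section dyadic.
Context (R : realType) (X : pseudoPMetricType R) (A : seq bool -> set X).
Local Notation M := (M1 X).
Local Notation BX := (borelType X).
Hypothesis Atree : dyadic_tree A.
Hypothesis Ares : resolving A.

Lemma tree_measurable e : measurable (A e : set BX).
Proof.
rewrite /measurable/=; move: Ares; rewrite /resolving => <-.
by apply: sub_sigma_algebra; exists e.
Qed.

Lemma tree_rcons e b : A (rcons e b) `<=` A e.
Proof. by move=> x Ax; rewrite (Atree.2 e).1; case: b Ax; [right|left]. Qed.

Lemma tree_cat e s : A (e ++ s) `<=` A e.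
Proof.
elim/last_ind: s => [|s b IH]; first by rewrite cats0.
by rewrite -rcons_cat; apply: subset_trans (@tree_rcons _ _) IH.
Qed.

Lemma tree_inj e e' x : size e = size e' -> A e x -> A e' x -> e = e'.
Proof.
elim/last_ind: e e' => [|e b IH] e'; first by case: e'.
case/lastP: e' => [|e' b']; rewrite !size_rcons// => -[se] Ax Ax'.
have E : e = e' by apply: IH => //; [exact: tree_rcons Ax|exact: tree_rcons Ax'].
move: Ax Ax'; rewrite -{}E => Ax Ax'; congr rcons.
have d := (Atree.2 e).2; case: b Ax; case: b' Ax' => // h1 h2.
  by move/seteqP : d => [/(_ x) h _]; have := h (conj h1 h2).
by move/seteqP : d => [/(_ x) h _]; have := h (conj h2 h1).
Qed.

Lemma tree_cover m x : exists e : m.-tuple bool, A e x.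
Proof.
elim: m => [|m [e Ae]].
  by exists [tuple]; rewrite /= Atree.1.
move: Ae; rewrite (Atree.2 e).1 => -[Ae|Ae].
  by exists [tuple of rcons e false].
by exists [tuple of rcons e true].
Qed.

(** Two nodes are nested or disjoint; adding the empty set therefore makes the family stable under
    intersections, as Dynkin induction needs. *)
Definition tree_sets : set (set BX) := [set B | B = set0 \/ range A B].

Lemma tree_setI_closed : setI_closed tree_sets.
Proof.
suff h e e' : (size e <= size e')%N -> tree_sets (A e `&` A e').
  move=> B B' [->|[e _ <-]]; first by left; rewrite set0I.
  case=> [->|[e' _ <-]]; first by left; rewrite setI0.
  have [ee'|/ltnW e'e] := leqP (size e) (size e'); first exact: h.
  by rewrite setIC; exact: h.
move=> se; have [eq|neq] := eqVneq e (take (size e) e').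
  right; exists e' => //; apply/esym/setIidPr.
  by rewrite -{1}(cat_take_drop (size e) e') -eq; exact: tree_cat.
left; apply/seteqP; split => // x [Ax Ax']; move/eqP : neq; apply.
apply: (@tree_inj _ _ x) => //; first by rewrite size_takel.
by move: Ax'; rewrite -{1}(cat_take_drop (size e) e'); exact: tree_cat.
Qed.

Lemma tree_setsE : (@measurable _ BX) = <<s tree_sets >>.
Proof.
rewrite /measurable/=; move: Ares; rewrite /resolving => <-; apply/seteqP; split.
  by apply: sub_smallest2r => // _ [e _ <-]; right; exists e.
apply: smallest_sub; first exact: smallest_sigma_algebra.
move=> _ [->|[e _ <-]]; last by apply: sub_sigma_algebra; exists e.
exact: sigma_algebra0.
Qed.

Variables (G : probability BX R) (c : R).

(** Dynkin induction on [B]. The only delicate case is a disjoint union, where the limit along [F]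
    and the series must be exchanged; the uniform tail bound allows it. *)
Lemma cvg_add_dominated (T : Type) (F : set_system T) (FF : Filter F)
    (phi : T -> set BX -> R) (P0 : M) :
  F [set t | add_dominated G c (phi t)] ->
  (forall e, (fun t => phi t (A e)) @ F --> pr P0 (A e)) ->
  forall B : set BX, measurable B -> (fun t => phi t B) @ F --> pr P0 B.
Proof.
move=> FK FA B mB.
have : <<s tree_sets >> B by rewrite -tree_setsE.
apply: (@dynkin_induction _ BX tree_sets (fun B => (fun t => phi t B) @ F --> pr P0 B)) => //.
- exact: tree_setsE.
- exact: tree_setI_closed.
- by rewrite prT; apply: cvg_near_cst; apply: filterS FK => t [].
- move=> _ [->|[e _ <-]]; last exact: FA.
  by rewrite pr0; apply: cvg_near_cst; apply: filterS FK => t /add_dominated0.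
- move=> S mS cS; rewrite pr_setC//.
  apply: (@cvg_trans _ ((fun t => 1 - phi t S) @ F)).
    apply: near_eq_cvg; apply: filterS FK => t Kt.
    by rewrite (add_dominatedC Kt).
  by apply: cvgB => //; exact: cvg_cst.
move=> S mS tS cS; have [t [t0 tP]] := add_dominated_tail G c mS tS.
apply/cvgrPdist_lt => e e0; have e3 : 0 < e / 3 by rewrite divr_gt0.
have := pr_bigcup_cvg (P := P0) mS tS => /cvgrPdist_lt /(_ _ e3) P03.
move/cvgrPdist_lt : t0 => /(_ _ e3) t3.
(* One [n] makes both remainders small, that of [P0] and that of all [phi t] at once; the last third
   of [e] pays for the finite sum. *)
have [n _ /(_ n (leqnn n))] := filterI P03 t3; rewrite /= sub0r normrN => -[Pn tn].
have cn : \sum_(i < n) phi t (S i) @[t --> F] --> \sum_(i < n) pr P0 (S i).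
  by apply: (@cvg_sumr _ _ _ FF n (fun i t => phi t (S i)) (fun i => pr P0 (S i))) => i _; exact: cS.
move/cvgrPdist_lt : cn => /(_ _ e3); move: FK; apply: filterS2 => x Kx.
have := tP _ n Kx; move: tn Pn.
by rewrite !ler_norml !ltr_norml; lra.
Qed.

Lemma cvg_pr_tree (F : set_system M) (FF : Filter F) (P0 : M) :
  F (quad_dominated G c) ->
  (forall e, (fun P : M => pr P (A e)) @ F --> pr P0 (A e)) ->
  forall B : set BX, measurable B -> pr P B @[P --> F] --> pr P0 B.
Proof.
move=> FK FA B mB.
apply: (@cvg_add_dominated M F FF (fun P : M => pr P)) => //.
by apply: filterS FK => P /quad_dominated_add.
Qed.

End dyadic.

(** * Cylinder sets *)

Section cylinder_algebra.
Context (R : realType) (X : pseudoPMetricType R) (A : seq bool -> set X).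
Local Notation M := (M1 X).
Local Notation BX := (borelType X).
Hypothesis Atree : dyadic_tree A.
Hypothesis Ares : resolving A.

Definition cyl_gen : set (set M) :=
  [set C | exists e (q : R), C = [set P : M | q < pr P (A e)]].

Definition M1cyl := g_sigma_algebraType cyl_gen.

Lemma measurable_pr_cyl e : measurable_fun setT ((fun P : M => pr P (A e)) : M1cyl -> R).
Proof.
apply: (measurability (@RGenOInfty.G R) (RGenOInfty.measurableE R)) => _ [_ [q ->] <-].
rewrite setTI; apply: sub_sigma_algebra; exists e, q.
by apply/seteqP; split => P /=; rewrite in_itv/= andbT.
Qed.

(** Rational bounds make the boxes countable in number: each is coded by an element of a countable
    type. *)
Let box (s : seq (seq bool * rat * rat)) : set M :=
  [set P : M | all (fun t => ratr t.1.2 < pr P (A t.1.1) < ratr t.2) s].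

Let measurable_box s : measurable (box s : set M1cyl).
Proof.
elim: s => [|[[e a] b] s IH].
  by rewrite (_ : box [::] = setT)//; apply/seteqP; split.
rewrite (_ : box _ = [set P : M | ratr a < pr P (A e) < ratr b] `&` box s).
  apply: measurableI => //.
  have := measurable_pr_cyl e measurableT (measurable_itv `]ratr a, ratr b[).
  rewrite setTI; congr measurable; apply/seteqP; split => P /=; by rewrite in_itv/=.
by apply/seteqP; split => P; rewrite /box /=; [move/andP|move=> h; apply/andP].
Qed.

Variables (G : probability BX R) (c : R) (S : set M).
Hypothesis SK : S `<=` quad_dominated G c.
Hypothesis mS : measurable (S : set M1cyl).

(** Along the filter generated by the traces on [S] of the boxes around [P0], the masses of tree
    sets converge to those of [P0]. By domination the masses of all Borel sets do too, so the filter
    contains every weak neighbourhood of [P0]. *)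
Lemma weak_open_box W P0 : weak_open W -> W P0 -> S P0 ->
  exists s, box s P0 /\ box s `&` S `<=` W.
Proof.
move=> oW WP0 SP0.
pose D := [set s | box s P0].
pose Fs s := box s `&` S.
have FF : Filter (filter_from D Fs).
  apply: filter_from_filter; first by exists [::].
  move=> s1 s2 D1 D2; exists (s1 ++ s2).
    by rewrite /D /box /= all_cat; apply/andP.
  by move=> P [+ SP]; rewrite /box /= all_cat => /andP[].
suff [s Ds sW] : filter_from D Fs W by exists s.
apply: (weak_open_nbhs FF (P0 := P0)) => //.
apply: (cvg_pr_tree Atree Ares (G := G) (c := c)) => //; last first.
- move=> e; apply/cvgrPdist_lt => eps eps0.
  have l1 : pr P0 (A e) - eps < pr P0 (A e) by rewrite ltrBlDr ltrDl.
  have l2 : pr P0 (A e) < pr P0 (A e) + eps by rewrite ltrDl.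
  have [a] := rat_in_itvoo l1; rewrite in_itv/= => /andP[a1 a2].
  have [b] := rat_in_itvoo l2; rewrite in_itv/= => /andP[b1 b2].
  exists [:: (e, a, b)]; first by rewrite /D /box /= a2 b1.
  move=> P [+ _]; rewrite /box /= andbT => /andP[h1 h2].
  by rewrite ltr_norml; apply/andP; split; lra.
by exists [::] => // P [_ /SK].
Qed.

Lemma cyl_weak_open W : weak_open W -> measurable (W `&` S : set M1cyl).
Proof.
move=> oW.
(* An enumeration of all rational boxes that keeps those whose trace on [S] lies in [W]; it replaces
   a possibly uncountable union by a countable one. *)
pose F k : set M := if @unpickle (seq (seq bool * rat * rat)) k is Some s then
   (if `[< box s `&` S `<=` W >] then box s `&` S else set0) else set0.
rewrite (_ : W `&` S = \bigcup_k F k).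
  apply: bigcupT_measurable => k; rewrite /F; case: unpickle => [s|]; last exact: measurable0.
  by case: ifP => _; [apply: measurableI; [exact: measurable_box|]|exact: measurable0].
apply/seteqP; split => P.
  move=> [WP SP]; have [s [sP sW]] := weak_open_box oW WP SP.
  by exists (pickle s) => //; rewrite /F pickleK; case: asboolP.
move=> [k _]; rewrite /F; case: unpickle => [s|] //.
by case: asboolP => // sW h; split; [exact: sW|case: h].
Qed.

Lemma cyl_weak_measurable (B : set (M1weak X)) : measurable B ->
  measurable (B `&` S : set M1cyl).
Proof.
move: B; apply: smallest_sub; last by move=> W oW; exact: cyl_weak_open.
split => [|B mB|F mF] /=.
- by rewrite set0I; exact: measurable0.
- rewrite setTD (_ : ~` B `&` S = S `\` (B `&` S)).
    exact: measurableD.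
  by apply/seteqP; split => P /=; [move=> [nB SP]; split => // -[]|move=> [SP nB]; split => // BP; exact: nB].
- by rewrite setI_bigcupl; exact: bigcupT_measurable.
Qed.

End cylinder_algebra.

(** * Cylinder sets are weak Borel and tight Borel *)

Section cylinder_inclusions.
Context (R : realType) (X : pseudoPMetricType R) (A : seq bool -> set X).
Local Notation M := (M1 X).
Local Notation BX := (borelType X).
Hypothesis Ares : resolving A.

Lemma weak_measurable_cyl (B : set (M1cyl A)) : measurable B -> measurable (B : set (M1weak X)).
Proof.
move: B; apply: smallest_sub; first exact: smallest_sigma_algebra.
move=> _ [e [q ->]]; apply: sub_sigma_algebra.
by apply: (@weak_open_pr _ _ (A e) [set y | q < y]); [exact: tree_measurable|exact: open_gt].
Qed.

(** The set [C n] of centres of balls of radius [1/(n+1)] inside [U] is uniformly separated from the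
    complement of [U], so a Urysohn function is 1 on it and 0 off [U]; every point of [U] lies in
    [C n] from some [n] on. *)
Lemma open_approx (U : set X) : open U ->
  exists f : nat -> X -> R, (forall n, continuous (f n)) /\
    (forall n x, 0 <= f n x <= 1) /\ (forall x, (f n x @[n --> \oo] --> (\1_U x : R))).
Proof.
move=> oU; pose C n : set X := [set x | ball x (n.+1%:R^-1 : R) `<=` U].
have sep n : uniform_separator (~` U) (C n).
  apply: uniform_separatorW; exists [set xy | ball xy.1 (n.+1%:R^-1 : R) xy.2].
    by rewrite -entourage_ballE; exists (n.+1%:R^-1) => //=; rewrite invr_gt0.
  apply/seteqP; split => // -[x y] /= [[nUx Cy] /ball_sym /Cy Ux]; exact: nUx.
exists (fun n => Urysohn (~` U) (C n)); split; [|split].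
- by move=> n; exact: Urysohn_continuous.
- move=> n x; have /(_ (Urysohn (~` U) (C n) x)) := @Urysohn_range X R (~` U) (C n).
  by rewrite /= in_itv/=; apply; exists x.
- move=> x; rewrite indicE; have [Ux|nUx] := boolP (x \in U); last first.
    apply: cvg_near_cst; apply: nearW => n.
    apply: (Urysohn_sub0 (sep n)); exists x => //.
    by move/negP: nUx; rewrite inE.
  move: Ux; rewrite inE => Ux.
  have [r /= r0 Br] : nbhs_ball x U by apply/nbhs_ballP/open_nbhs_nbhs.
  apply: cvg_near_cst; exists (Num.truncn r^-1) => // n /= rn.
  apply: (Urysohn_sub1 (sep n)); exists x => // y xy; apply: Br.
  apply: le_ball xy; rewrite -[leRHS]invrK lef_pV2 ?posrE ?invr_gt0//.
  rewrite ltW// (lt_le_trans (truncnS_gt _))// ler_nat//.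
Qed.

Lemma measurable_tight_Rintegral (f : X -> R) : continuous f -> (exists C : R, forall x, `|f x| <= C) ->
  measurable_fun setT ((fun P : M => \int[P]_x f x) : M1tight X -> R).
Proof.
move=> cf bf; apply: (measurability (@RGenOInfty.G R) (RGenOInfty.measurableE R)) => _ [_ [a ->] <-].
rewrite setTI; apply: sub_sigma_algebra => P VP.
exists 1%N, (fun=> [set P : M | `]a, +oo[%classic (\int[P]_x f x)]); split => [i _|Q /(_ 0%N)]; last exact.
split => //; exists f, `]a, +oo[%classic; by split => //; split => //; split.
Qed.

(** For open sets the map is a pointwise limit of integrals of continuous functions, and Dynkin
    induction reaches all Borel sets. This is what lets [Q] measure cylinder sets and average the
    masses [P(B)] into a mean measure. *)
Lemma measurable_tight_pr (B : set BX) : measurable B ->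
  measurable_fun setT ((fun P : M => pr P B) : M1tight X -> R).
Proof.
have mcont (f : X -> R) : continuous f -> measurable_fun setT (f : BX -> R).
  move=> cf; apply: (measurability (@RGenOInfty.G R) (RGenOInfty.measurableE R)) => _ [_ [a ->] <-].
  by rewrite setTI; apply: sub_sigma_algebra; apply: open_comp => // x _; exact: cf.
move: B; apply: (@dynkin_induction _ BX open (fun B => measurable_fun setT ((fun P : M => pr P B) : M1tight X -> R))) => //.
- by move=> U V oU oV; exact: openI.
- by under eq_fun do rewrite prT; exact: measurable_cst.
- move=> U oU; have mU : measurable (U : set BX) by exact: sub_sigma_algebra.
  have [f [cf [f01 fU]]] := open_approx oU.
  have fb n x : `|f n x| <= 1 by have /andP[a b] := f01 n x; rewrite ger0_norm.
  apply: (measurable_fun_cvg (h := fun n (P : M1tight X) => \int[P : M]_x f n x)) => //.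
    by move=> n; apply: measurable_tight_Rintegral => //; exists 1.
  move=> P _; rewrite -(Rintegral_indic_pr (P : M) mU).
  have := @dominated_convergence _ BX R (P : M) setT measurableT (fun n x => (f n x)%:E)
     (fun x => (\1_U x)%:E) (cst 1%E).
  case.
  + by move=> n; apply/measurable_EFinP; exact: mcont.
  + by apply/measurable_EFinP; exact: measurable_indic.
  + by apply: aeW => x _; apply: cvg_EFin; [exact: nearW|exact: fU].
  + exact: (bounded_integrable (P : M) (measurable_cst (1 : R)) (M := 1) (fun=> ltac:(by rewrite normr1))).
  + by apply: aeW => x n _; rewrite /= lee_fin.
  move=> _ _ cv; apply: fine_cvg; rewrite fineK//.
  by apply: integrable_fin_num => //; apply: (@bounded_integrable _ BX R (P : M) _ 1);
    [exact: measurable_indic|move=> x; rewrite indicE; case: (_ \in _); rewrite ?normr1 ?normr0].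
- move=> S mS cS; under eq_fun do rewrite pr_setC//; exact: measurable_funB.
- move=> F mF tF cF; apply: (measurable_fun_cvg (h := fun n (P : M1tight X) => \sum_(i < n) pr (P : M) (F i))) => //.
    by move=> n; apply: measurable_sum.
  by move=> P _; exact: pr_bigcup_cvg.
Qed.

Lemma tight_measurable_cyl (B : set (M1cyl A)) : measurable B -> measurable (B : set (M1tight X)).
Proof.
move: B; apply: smallest_sub; first exact: smallest_sigma_algebra.
move=> _ [e [q ->]].
have := measurable_tight_pr (tree_measurable Ares e) measurableT (measurable_itv `]q, +oo[).
rewrite setTI; congr measurable; apply/seteqP; split => P /=; by rewrite in_itv/= andbT.
Qed.

End cylinder_inclusions.

(** * Energy of a probability along the tree *)

Lemma sum_tupleS (V : nmodType) m (F : seq bool -> V) :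
  \sum_(e : m.+1.-tuple bool) F e =
  \sum_(e : m.-tuple bool) (F (rcons e false) + F (rcons e true)).
Proof.
pose h (p : m.-tuple bool * bool) : m.+1.-tuple bool := [tuple of rcons p.1 p.2].
have hb : bijective h.
  apply: inj_card_bij; last by rewrite card_prod !card_tuple card_bool expnS mulnC.
  move=> [e b] [e' b'] /(congr1 val) /= /rcons_inj [ee' ->].
  by congr pair; exact: val_inj.
rewrite (reindex h) /=; last exact: onW_bij.
rewrite -(pair_bigA _ (fun (e : m.-tuple bool) b => F (rcons e b)))/=.
by apply: eq_bigr => e _; rewrite big_bool addrC.
Qed.

Lemma weighted_cauchy_schwarz (R : realFieldType) (I : finType) (a g : I -> R) :
  (forall i, 0 <= g i) ->
  (\sum_i a i * g i) ^+ 2 <= (\sum_i a i ^+ 2 * g i) * \sum_i g i.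
Proof.
move=> g0; set Y := \sum_i a i * g i; set W := \sum_i a i ^+ 2 * g i; set Z := \sum_i g i.
have Z0 : 0 <= Z by exact: sumr_ge0.
have [Zp|] := ltP 0 Z; last first.
  move=> Zn; have Ze : Z = 0 by apply/eqP; rewrite eq_le Zn Z0.
  have gz i : g i = 0.
    by move/eqP: Ze; rewrite psumr_eq0// => /allP/(_ i); rewrite mem_index_enum => /(_ isT)/eqP.
  rewrite Ze mulr0 /Y big1 ?expr0n// => i _; by rewrite gz mulr0.
(* The [g]-weighted variance of [a], cleared of denominators; it equals [Z * (W * Z - Y ^+ 2)],
   which is why [Z] had to be positive. *)
have : 0 <= \sum_i g i * (a i * Z - Y) ^+ 2.
  by apply: sumr_ge0 => i _; rewrite mulr_ge0// sqr_ge0.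
have -> : \sum_i g i * (a i * Z - Y) ^+ 2 = Z ^+ 2 * W - 2 * Z * Y * Y + Y ^+ 2 * Z.
  have E z y : \sum_i g i * (a i * z - y) ^+ 2 =
      z ^+ 2 * (\sum_i a i ^+ 2 * g i) - 2 * z * y * (\sum_i a i * g i) + y ^+ 2 * \sum_i g i.
    by rewrite !mulr_sumr -sumrB -big_split/=; apply: eq_bigr => i _; ring.
  exact: E.
have -> : Z ^+ 2 * W - 2 * Z * Y * Y + Y ^+ 2 * Z = Z * (W * Z - Y ^+ 2) by ring.
by rewrite pmulr_rge0// subr_ge0.
Qed.

Section energy.
Context (R : realType) (X : pseudoPMetricType R) (A : seq bool -> set X).
Local Notation M := (M1 X).
Local Notation BX := (borelType X).
Hypothesis Atree : dyadic_tree A.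
Hypothesis Ares : resolving A.
Variables (G : probability BX R).
Hypothesis GA : forall e, 0 < pr G (A e).

Let mA e : measurable (A e : set BX) := tree_measurable Ares e.

Definition energy m (P : M) : R :=
  \sum_(e : m.-tuple bool) pr P (A e) ^+ 2 / pr G (A e).

Lemma pr_tree (P : M) e : pr P (A e) = pr P (A (rcons e false)) + pr P (A (rcons e true)).
Proof. by have [{1}-> d] := Atree.2 e; rewrite (prU P (mA _) (mA _)). Qed.

Lemma energy_ge0 m P : 0 <= energy m P.
Proof. by apply: sumr_ge0 => e _; rewrite divr_ge0// ?sqr_ge0// ltW. Qed.

(** Refining a partition increases the squared norm of the conditional density; in each cell the
    increment is a square over a positive denominator. *)
Lemma energyS m P : energy m P <= energy m.+1 P.
Proof.
rewrite /energy (sum_tupleS m (fun e => pr P (A e) ^+ 2 / pr G (A e))).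
apply: ler_sum => e _; rewrite (pr_tree P) (pr_tree (G : M)).
have := GA (rcons e false); have := GA (rcons e true).
set g1 := pr G _; set g0 := pr G _; set p0 := pr P _; set p1 := pr P _ => h1 h0.
rewrite -subr_ge0.
have -> : p0 ^+ 2 / g0 + p1 ^+ 2 / g1 - (p0 + p1) ^+ 2 / (g0 + g1) =
   (p0 * g1 - p1 * g0) ^+ 2 / (g0 * g1 * (g0 + g1)).
  by field; rewrite !gt_eqF// addr_gt0.
by rewrite divr_ge0 ?sqr_ge0// !mulr_ge0// ltW// addr_gt0.
Qed.

Lemma energy_nd m n P : (m <= n)%N -> energy m P <= energy n P.
Proof.
elim: n => [|n IH]; first by rewrite leqn0 => /eqP->.
rewrite leq_eqVlt => /orP[/eqP->//|]; rewrite ltnS => /IH h.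
exact: le_trans h (energyS _ _).
Qed.

Lemma pr_level (P : M) m (B : set BX) : measurable B ->
  pr P B = \sum_(e : m.-tuple bool) pr P (B `&` A e).
Proof.
move=> mB.
suff h (s : seq (m.-tuple bool)) : uniq s ->
    pr P (\big[setU/set0]_(e <- s) (B `&` A e)) = \sum_(e <- s) pr P (B `&` A e).
  rewrite -h ?index_enum_uniq//; congr pr; apply/seteqP; split => x.
    move=> Bx; have [e Ae] := tree_cover Atree m x.
    by rewrite -bigcup_seq; exists e => //=; rewrite mem_index_enum.
  by rewrite -bigcup_seq => -[e _ []].
elim: s => [|e s IH]; first by rewrite !big_nil pr0.
rewrite /= => /andP[es us]; rewrite !big_cons prU ?IH//.
- by apply: measurableI.
- by apply: bigsetU_measurable => i _; exact: measurableI.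
apply/seteqP; split => // x [[_ Ae]]; rewrite -bigcup_seq => -[e' /= e's [_ Ae']].
have E : val e = val e' by apply: (tree_inj Atree _ Ae Ae'); rewrite !size_tuple.
by move: es; rewrite (val_inj E) e's.
Qed.

(* The measure whose density relative to [G] is the density of [P] on level [m]. *)
Let phi (P : M) m (B : set BX) : R :=
  \sum_(e : m.-tuple bool) pr P (A e) / pr G (A e) * pr G (B `&` A e).

Lemma phi_tree P m e : (size e <= m)%N -> phi P m (A e) = pr P (A e).
Proof.
move=> em; rewrite [RHS](pr_level P m)// /phi; apply: eq_bigr => e' _.
have [eq|neq] := eqVneq e (take (size e) e').
  have -> : A e `&` A e' = A e'.
    apply/setIidPr; rewrite -{1}(cat_take_drop (size e) e') -eq; exact: tree_cat.
  by rewrite divfK// gt_eqF.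
have -> : A e `&` A e' = set0; last by rewrite !pr0 mulr0.
apply/seteqP; split => // x [Ax Ax']; move/eqP : neq; apply.
apply: (tree_inj Atree _ Ax); first by rewrite size_takel// size_tuple.
by move: Ax'; rewrite -{1}(cat_take_drop (size e) e'); exact: tree_cat.
Qed.

Variable c : R.

(** Cauchy-Schwarz with the weights [pr G (B I A e)], [I] being intersection: their sum is [pr G B],
    and enlarging each to [pr G (A e)] in the other factor gives the energy. *)
Lemma phi_add_dominated P m : energy m P <= c -> add_dominated G c (phi P m).
Proof.
move=> Ec.
have mI (B : set BX) (e : m.-tuple bool) : measurable B -> measurable (B `&` A e : set BX).
  by move=> mB; exact: measurableI.
have w0 (e : m.-tuple bool) : 0 <= pr P (A e) / pr G (A e) by rewrite divr_ge0 ?pr_ge0.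
split.
- by rewrite -Atree.1 phi_tree// Atree.1 prT.
- by move=> B _; apply: sumr_ge0 => e _; rewrite mulr_ge0// pr_ge0.
- move=> B C mB mC BC; rewrite /phi -big_split/=; apply: eq_bigr => e _.
  rewrite setIUl prU ?mulrDr//; [exact: mI|exact: mI|].
  by rewrite setIACA BC set0I.
- move=> B mB; apply: le_trans (weighted_cauchy_schwarz _ _) _.
    by move=> e; exact: pr_ge0.
  rewrite -(pr_level (G : M) m mB) ler_wpM2r ?pr_ge0//.
  apply: le_trans Ec; apply: ler_sum => e _.
  set p := pr P _; set g := pr G (A e).
  have g0 : g != 0 by rewrite gt_eqF// GA.
  have -> : p ^+ 2 / g = (p / g) ^+ 2 * g by field.
  by rewrite ler_wpM2l ?sqr_ge0//; apply: le_pr => //; exact: mI.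
Qed.

(** On each tree set the approximations [phi P m] eventually equal [P], and they are dominated with
    the same [c]; hence they converge to [P] on every Borel set and hand over the inequality. *)
Lemma energy_quad_dominated P : (forall m, energy m P <= c) -> quad_dominated G c P.
Proof.
move=> Ec B mB.
have cphi : (fun m => phi P m B) @ \oo --> pr P B.
  apply: (cvg_add_dominated Atree Ares (G := G) (c := c)) => //.
    by exists 0%N => // m _; exact: phi_add_dominated.
  move=> e; apply: cvg_near_cst; exists (size e) => // m /= em.
  exact: phi_tree.
have cphi2 : (fun m => phi P m B ^+ 2) @ \oo --> pr P B ^+ 2.
  by rewrite expr2; under eq_fun do rewrite expr2; exact: cvgM.
apply: (cvgr_to_le cphi2); apply: nearW => m.
by have [_ _ _] := phi_add_dominated (Ec m); exact.
Qed.

End energy.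

(** * Moments of Polya histograms *)

Section beta_law_moments.
Context (R : realType) d (Om : measurableType d) (Pr : probability Om R).
Variables (Y : Om -> R) (a b : R).
Hypothesis mY : measurable_fun setT Y.
Hypotheses (a0 : 0 < a) (b0 : 0 < b).
Hypothesis lawY : forall B, measurable B -> Pr (Y @^-1` B) = beta_law a b B.
Notation mu := (@lebesgue_measure R).

(* A divergent integral would give the junk value [beta_const a b = 0], hence a law of total mass 0. *)
Lemma beta_law_const : 0 < beta_const a b /\ beta_integrable a b.
Proof.
have c0 : beta_const a b != 0.
  apply/eqP => c0; have := lawY measurableT; rewrite preimage_setT.
  have -> : (Pr setT = 1)%E := probability_setT Pr.
  rewrite /beta_law c0 setTI; under eq_integral do rewrite invr0 mulr0.
  by rewrite integral0 => /eqP; rewrite eqe oner_eq0.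
have cp : 0 < beta_const a b.
  by rewrite lt_neqAle eq_sym c0/=; apply: Rintegral_ge0 => x _; exact: beta_dens_ge0.
split => //; apply/integrableP; split; first by apply/measurable_EFinP; exact: measurable_beta_dens.
rewrite ltNge leye_eq; apply/negP => /eqP oo; move/eqP : c0; apply.
rewrite /beta_const /Rintegral.
suff -> : (\int[mu]_(x in `[0%R, 1%R]) (beta_dens a b x)%:E = +oo)%E by [].
apply: etrans oo; apply: eq_integral => x _ /=; rewrite ger0_norm//; exact: beta_dens_ge0.
Qed.

Lemma beta_law_Rintegral (h : R -> R) : measurable_fun setT h -> (forall x, 0 <= h x) ->
  \int[Pr]_w h (Y w) =
  (\int[mu]_(x in `[0, 1]) (h x * (beta_dens a b x / beta_const a b))).
Proof.
move=> mh h0; have [c0 ib] := beta_law_const.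
pose Yp : {mfun Om >-> R} := HB.pack Y (isMeasurableFun.Build _ _ _ _ _ mY).
pose D x := beta_dens a b x / beta_const a b * \1_(`[0, 1]%classic : set R) x.
have mD : measurable_fun setT (D : measurableTypeR R -> R).
  apply: measurable_funM; last exact: measurable_indic.
  by apply: measurable_funM => //; exact: measurable_beta_dens.
have D0 x : 0 <= D x.
  apply: mulr_ge0; first by rewrite divr_ge0 ?beta_dens_ge0// ltW.
  by rewrite indicE ler0n.
have nuE B : measurable B -> (distribution Pr Yp B = \int[mu]_(x in id @^-1` B) (D x)%:E)%E.
  move=> mB; rewrite /distribution /pushforward/= lawY// /beta_law.
  rewrite [LHS]integral_mkcond [RHS]integral_mkcond; apply: eq_integral => x _.
  rewrite !patchE /D indicE in_setI preimage_id.
  by case: (x \in B) => //=; case: (x \in _); rewrite ?mulr1 ?mulr0.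
have := @ge0_integral_law _ _ (measurableTypeR R) R R mu (distribution Pr Yp) id D
  (@measurable_id _ _ _) mD D0 nuE (EFin \o h).
have mhE : measurable_fun setT (EFin \o h) by exact/measurable_EFinP.
move=> /(_ mhE).
have hE0 x : (0 <= (EFin \o h) x)%E by rewrite lee_fin.
move=> /(_ hE0); rewrite ge0_integral_pushforward//.
rewrite preimage_setT => E; rewrite /Rintegral; congr fine.
transitivity (\int[Pr]_x (EFin \o h \o Yp) x)%E; first by [].
rewrite E [RHS]integral_mkcond; apply: eq_integral => x _.
rewrite patchE /D indicE -EFinM; case: (x \in _); first by rewrite mulr1.
by rewrite mulr0 mulr0.
Qed.

(** The product formula takes factors with values in the unit interval everywhere, whereas the beta
    variables lie there only almost surely. *)
Definition clip (y : R) : R := Num.max 0 (Num.min 1 y).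

Lemma clip01 y : 0 <= clip y <= 1.
Proof. by rewrite /clip le_max lexx/= ge_max ler01/= ge_min lexx. Qed.

Lemma clip_id y : 0 <= y <= 1 -> clip y = y.
Proof. by move=> /andP[y0 y1]; rewrite /clip min_r// max_r. Qed.

Lemma clip_unit x : x \in `[0, 1] -> clip x = x /\ clip (1 - x) = 1 - x.
Proof.
rewrite in_itv/= => /andP[x0 x1]; rewrite !clip_id ?x0//.
by rewrite subr_ge0 x1 lerBlDr lerDl.
Qed.

Lemma measurable_clip : measurable_fun setT clip.
Proof. by apply: measurable_maxr => //; exact: measurable_minr. Qed.

(** A factor [x] or [1 - x] raises a parameter of the density by one, so moments are quotients of
    beta constants, which [beta_constS] evaluates. *)
Lemma beta_law_factor (h : R -> R) (a' b' : R) :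
  measurable_fun setT h -> (forall x, 0 <= h x) -> beta_integrable a' b' ->
  (forall x, x \in `[0, 1] -> h x * beta_dens a b x = beta_dens a' b' x) ->
  \int[Pr]_w h (Y w) = beta_const a' b' / beta_const a b.
Proof.
move=> mh h0 iab' hE; rewrite beta_law_Rintegral// /beta_const -RintegralZr//.
by apply: eq_Rintegral => x; rewrite inE/= => x01; rewrite mulrA hE.
Qed.

Lemma beta_law_moments :
  [/\ \int[Pr]_w clip (Y w) = a / (a + b),
      \int[Pr]_w clip (1 - Y w) = b / (a + b),
      \int[Pr]_w clip (Y w) ^+ 2 = a / (a + b) * ((a + 1) / (a + b + 1)) &
      \int[Pr]_w clip (1 - Y w) ^+ 2 = b / (a + b) * ((b + 1) / (a + b + 1))].
Proof.
have [c0 ib] := beta_law_const.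
have [i1 i2] := beta_integrableS a0 b0 ib; have [E1 E2] := beta_constS a0 b0 ib.
have a1 : 0 < a + 1 by rewrite addr_gt0.
have b1 : 0 < b + 1 by rewrite addr_gt0.
have [i3 _] := beta_integrableS a1 b0 i1; have [_ i4] := beta_integrableS a0 b1 i2.
have [E3 _] := beta_constS a1 b0 i1; have [_ E4] := beta_constS a0 b1 i2.
have mc := measurable_clip.
have mc1 : measurable_fun setT (fun y : R => clip (1 - y)).
  by apply: (measurableT_comp mc); exact: measurable_funB.
have cl := clip_unit.
have cn0 : beta_const a b != 0 by rewrite gt_eqF.
split.
- rewrite (beta_law_factor mc _ i1) ?E1 ?mulfK//.
    by move=> x; have /andP[] := clip01 x.
  by move=> x x01; rewrite (cl x x01).1 beta_densSl.
- rewrite (beta_law_factor mc1 _ i2) ?E2 ?mulfK//.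
    by move=> x; have /andP[] := clip01 (1 - x).
  by move=> x x01; rewrite (cl x x01).2 beta_densSr.
- rewrite (@beta_law_factor (fun y => clip y ^+ 2) _ _ _ _ i3).
  + by rewrite E3 E1 addrAC [_ * (a / _ * _)]mulrA mulfK// mulrC.
  + by apply: measurable_funX.
  + by move=> x; rewrite sqr_ge0.
  + by move=> x x01; rewrite (cl x x01).1 beta_densSl// beta_densSl// expr2 mulrA.
- rewrite (@beta_law_factor (fun y => clip (1 - y) ^+ 2) _ _ _ _ i4).
  + by rewrite E4 E2 addrA [_ * (b / _ * _)]mulrA mulfK// mulrC.
  + exact: (measurable_funX 2 mc1).
  + by move=> x; rewrite sqr_ge0.
  + by move=> x x01; rewrite (cl x x01).2 beta_densSr// beta_densSr// expr2 mulrA.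
Qed.

Lemma beta_law_01 : {ae Pr, forall w, 0 <= Y w <= 1}.
Proof.
exists (Y @^-1` (~` `[0, 1]%classic)); split.
- by rewrite -[X in measurable X]setTI; apply: mY => //; apply: measurableC.
- by rewrite lawY /beta_law ?setICl ?integral_set0//; apply: measurableC.
- by move=> w /= h; rewrite in_itv/=.
Qed.

End beta_law_moments.

Lemma prod_iota (R : pzSemiRingType) n (F : nat -> R) :
  \prod_(l <- iota 0 n) F l = \prod_(l < n) F l.
Proof. by rewrite -(big_mkord xpredT F) /index_iota subn0. Qed.

Section polya_moments.
Context (R : realType) (beta : seq bool -> R) (dO : measure_display)
  (Om : measurableType dO) (Pr : probability Om R) (V : seq bool -> Om -> R).
Hypothesis beta0 : forall e b, 0 < beta (rcons e b).
Hypothesis PV : polya_variables beta Pr V.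

Let mV e : measurable_fun setT (V e) := PV.1 e.

(** Independence is given for left children only, so every factor is expressed through the left
    child of its parent. *)
Let hb (b : bool) (y : R) : R := if b then 1 - y else y.

Lemma polya_child e b w : V (rcons e b) w = hb b (V (rcons e false) w).
Proof. by case: b => //; exact: PV.2.1. Qed.

Lemma polya_ae01 : {ae Pr, forall w, forall l e, 0 <= V (rcons (take l e) false) w <= 1}.
Proof.
have h (e : seq bool) : {ae Pr, forall w, 0 <= V (rcons e false) w <= 1}.
  exact: (beta_law_01 (mV _) (PV.2.2.1 e)).
have h' : {ae Pr, forall w, forall n, 0 <= V (rcons (odflt [::] (unpickle n)) false) w <= 1}.
  by apply: ae_foralln => n; exact: h.
apply: filterS h' => w hw l e.
by have := hw (pickle (take l e)); rewrite pickleK.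
Qed.

Definition polya_prod (e : seq bool) (w : Om) : R := \prod_(l < size e) V (take l.+1 e) w.

Lemma measurable_polya_prod e : measurable_fun setT (polya_prod e).
Proof. by apply: measurable_prod => l _; exact: mV. Qed.

(** The factor of the path [e] at its node [p], where [size p] selects the bit taken there. Indexing
    by nodes fits the independent family. *)
Let hc k (e p : seq bool) (y : R) : R := clip (hb (nth false e (size p)) y) ^+ k.

Let hc01 k e p y : 0 <= hc k e p y <= 1.
Proof.
have /andP[a b] := clip01 (hb (nth false e (size p)) y).
by rewrite /hc exprn_ge0//= exprn_ile1.
Qed.

Let mhc k e p : measurable_fun setT (hc k e p).
Proof.
apply: measurable_funX; apply: (measurableT_comp (@measurable_clip R)).
by rewrite /hb; case: (nth _ _ _) => //; exact: measurable_funB.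
Qed.

Lemma polya_prod_clip k e : {ae Pr, forall w, polya_prod e w ^+ k =
  \prod_(p <- [seq take l e | l <- iota 0 (size e)]) hc k e p (V (rcons p false) w)}.
Proof.
apply: filterS polya_ae01 => w hw.
rewrite big_map /polya_prod -prodrXl prod_iota.
apply: eq_bigr => l _; rewrite /hc size_takel; last exact: ltnW.
rewrite (take_nth false)// polya_child clip_id//.
by rewrite /hb; have := hw l e; case: (nth _ _ _) => // /andP[a b]; rewrite subr_ge0 b/= lerBlDr lerDl.
Qed.

Lemma polya_prod_ge0 e : {ae Pr, forall w, 0 <= polya_prod e w}.
Proof.
apply: filterS (polya_prod_clip 1 e) => w; rewrite expr1 => ->.
by apply: prodr_ge0 => p _; have /andP[] := hc01 1 e p (V (rcons p false) w).
Qed.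

Lemma polya_prod_moment k e : \int[Pr]_w (polya_prod e w ^+ k) =
  \prod_(l < size e) \int[Pr]_w hc k e (take l e) (V (rcons (take l e) false) w).
Proof.
transitivity (\int[Pr]_w \prod_(p <- [seq take l e | l <- iota 0 (size e)])
    hc k e p (V (rcons p false) w)).
  rewrite /Rintegral; congr fine; apply: ae_eq_integral => //.
  - by apply/measurable_EFinP; apply: measurable_funX; exact: measurable_polya_prod.
  - apply/measurable_EFinP; apply: measurable_prod => p _.
    by apply: measurableT_comp; [exact: mhc|exact: mV].
  - by apply: filterS (polya_prod_clip k e) => w -> _.
rewrite (@indep_prod _ _ Om Pr _ (fun p => V (rcons p false)) (fun p => mV _) PV.2.2.2 (hc k e) (mhc k e) (hc01 k e)).
  by rewrite big_map prod_iota.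
(* The nodes along a path are distinct because their lengths are. *)
rewrite map_inj_in_uniq ?iota_uniq// => l l'; rewrite !mem_iota !add0n /= => ll ll' /(congr1 size).
by rewrite !size_takel// ltnW.
Qed.

Let hc1 l e : (l < size e)%N ->
  \int[Pr]_w hc 1 e (take l e) (V (rcons (take l e) false) w) =
  beta (take l.+1 e) / (beta (rcons (take l e) false) + beta (rcons (take l e) true)).
Proof.
move=> le; rewrite /hc size_takel; last exact: ltnW.
have [E1 E2 _ _] := beta_law_moments (mV _) (beta0 (take l e) false) (beta0 (take l e) true)
  (PV.2.2.1 (take l e)).
rewrite (take_nth false)//; under eq_Rintegral do rewrite expr1.
by rewrite /hb; case: (nth false e l).
Qed.

(** For a beta variable, [polya_term] is variance over mean, plus mean, which is second moment over
    mean. With [s] the sum of the two parameters it simplifies to [(beta + 1) / (s + 1)], [beta]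
    being the parameter of the chosen child. *)
Let hc2 l e : (l < size e)%N ->
  \int[Pr]_w hc 2 e (take l e) (V (rcons (take l e) false) w) =
  \int[Pr]_w hc 1 e (take l e) (V (rcons (take l e) false) w) * polya_term beta e l.
Proof.
move=> le; rewrite hc1// /hc size_takel; last exact: ltnW.
have [_ _ E1 E2] := beta_law_moments (mV _) (beta0 (take l e) false) (beta0 (take l e) true)
  (PV.2.2.1 (take l e)).
rewrite (take_nth false)// /polya_term.
have b0 := beta0 (take l e) false; have b1 := beta0 (take l e) true.
set x := beta (rcons _ false) in b0 E1 E2 *; set y := beta (rcons _ true) in b1 E1 E2 *.
have s0 : x + y != 0 by rewrite gt_eqF// addr_gt0.
have s1 : x + y + 1 != 0 by rewrite gt_eqF// addr_gt0// addr_gt0.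
rewrite /hb; case: (nth false e l) => /=.
  rewrite E2 -/x -/y; field; by rewrite s0 s1.
rewrite E1 -/x -/y; field; by rewrite s0 s1.
Qed.

Lemma polya_mean_gt0 e : 0 < \int[Pr]_w polya_prod e w.
Proof.
have := polya_prod_moment 1 e; under eq_Rintegral do rewrite expr1.
move=> ->; apply: prodr_gt0 => l _; rewrite hc1//.
by rewrite (take_nth false)// divr_gt0// addr_gt0.
Qed.

Lemma polya_second_moment e : \int[Pr]_w (polya_prod e w ^+ 2) =
  \int[Pr]_w polya_prod e w * \prod_(l < size e) polya_term beta e l.
Proof.
have := polya_prod_moment 1 e; under eq_Rintegral do rewrite expr1.
by move=> ->; rewrite polya_prod_moment -big_split/=; apply: eq_bigr => l _; rewrite hc2.
Qed.

End polya_moments.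

(** * Mean measure and expected energy *)

Section mean_measure_existence.
Context (R : realType) (X : pseudoPMetricType R).
Local Notation M := (M1 X).
Local Notation BX := (borelType X).
Variable Q : probability (M1tight X) R.
Local Open Scope ereal_scope.

(** The barycentre of [Q], from which the mean measure is obtained. *)
Definition mixture (B : set BX) : \bar R := \int[Q]_P (pr (P : M) B)%:E.

Let mprE (B : set BX) : measurable B ->
  measurable_fun setT (fun P : M1tight X => (pr (P : M) B)%:E).
Proof. by move=> mB; apply/measurable_EFinP; exact: measurable_tight_pr. Qed.

Let mixture0 : mixture set0 = 0.
Proof. by rewrite /mixture; under eq_integral do rewrite pr0; rewrite integral0. Qed.

Let mixture_ge0 B : 0 <= mixture B.
Proof. by apply: integral_ge0 => P _; rewrite lee_fin pr_ge0. Qed.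

Let mixtureT : mixture setT = 1.
Proof.
rewrite /mixture; under eq_integral do rewrite prT.
by rewrite integral_cst// mul1e; exact: probability_setT.
Qed.

Let mixture_sigma : semi_sigma_additive mixture.
Proof.
move=> F mF tF mU.
have -> : mixture (\bigcup_n F n) = \sum_(0 <= i <oo) mixture (F i).
  rewrite /mixture -integral_nneseries//; last 2 first.
  - by move=> n; exact: mprE.
  - by move=> n P _; rewrite lee_fin pr_ge0.
  apply: eq_integral => P _; apply/esym/cvg_lim => //.
  apply: (@cvg_trans _ ((fun n => (\sum_(i < n) pr (P : M) (F i))%:E) @ \oo)).
    by apply: near_eq_cvg; apply: nearW => n; rewrite big_mkord sumEFin.
  by apply: cvg_EFin; [exact: nearW|exact: pr_bigcup_cvg].
exact: is_cvg_ereal_nneg_natsum.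
Qed.

Lemma mixture_probability : exists G : probability BX R, forall B, G B = mixture B.
Proof.
pose G1 : {measure set BX -> \bar R} :=
  HB.pack mixture (isMeasure.Build _ _ _ mixture mixture0 mixture_ge0 mixture_sigma).
have GT1 : G1 setT = 1%E by exact: mixtureT.
pose G2 : probability BX R := HB.pack (Measure.sort G1)
  (Measure_isProbability.Build _ _ _ (Measure.sort G1) GT1).
by exists G2.
Qed.

End mean_measure_existence.

Section projections.
Context (R : realType) (X : pseudoPMetricType R) (A : seq bool -> set X)
  (beta : seq bool -> R) (dO : measure_display) (Om : measurableType dO)
  (Pr : probability Om R) (V : seq bool -> Om -> R).
Local Notation M := (M1 X).
Local Notation BX := (borelType X).
Hypothesis Atree : dyadic_tree A.
Hypothesis Ares : resolving A.
Hypothesis beta0 : forall e b, 0 < beta (rcons e b).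
Hypothesis PV : polya_variables beta Pr V.
Variable Q : probability (M1tight X) R.
Hypothesis Qproj : forall m, projects_to A Pr V Q m.

Let mA e : measurable (A e : set BX) := tree_measurable Ares e.

Lemma projection_law e (C : set R) : measurable C ->
  Q [set P | C (pr (P : M) (A e))] = Pr [set w | C (polya_prod V e w)].
Proof.
move=> mC.
have := Qproj (B := [set x : (size e).-tuple bool -> R | C (x (in_tuple e))]); apply.
by apply: sub_sigma_algebra; exists (in_tuple e), C.
Qed.

Lemma projection_integral e (h : R -> \bar R) : measurable_fun setT h ->
  (forall x, (0 <= h x)%E) ->
  (\int[Q]_P h (pr (P : M) (A e)) = \int[Pr]_w h (polya_prod V e w))%E.
Proof.
move=> mh h0.
pose Y : {mfun M1tight X >-> R} := HB.pack (fun P : M1tight X => pr (P : M) (A e))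
  (isMeasurableFun.Build _ _ _ _ _ (measurable_tight_pr (mA e))).
have nuE B : measurable B -> (distribution Q Y B = \int[Pr]_(x in polya_prod V e @^-1` B) (1%R)%:E)%E.
  move=> mB; rewrite integral_cst ?mul1e.
    exact: projection_law.
  rewrite -[X in measurable X]setTI; apply: (measurable_polya_prod PV) => //.
have := @ge0_integral_law _ _ Om R R Pr (distribution Q Y) (polya_prod V e) (cst 1)
  (measurable_polya_prod PV e) (measurable_cst _) (fun=> ler01) nuE h mh h0.
rewrite ge0_integral_pushforward//.
rewrite preimage_setT => ->; by apply: eq_integral => w _; rewrite mule1.
Qed.

Lemma projection_mean e :
  (\int[Q]_P (pr (P : M) (A e))%:E = \int[Pr]_w (polya_prod V e w)%:E)%E.
Proof.
(* [projection_integral] takes functions that are nonnegative on all of [R]; the truncation at 0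
   changes nothing for masses, and nothing almost surely for [polya_prod]. *)
have mm : measurable_fun setT (fun y : R => (Num.max 0 y)%:E).
  by apply/measurable_EFinP; apply: measurable_maxr.
have := @projection_integral e (fun y => (Num.max 0 y)%:E) mm.
have m0 (x : R) : (0 <= (Num.max 0 x)%:E)%E by rewrite lee_fin le_max lexx.
move=> /(_ m0) E; transitivity (\int[Q]_P (Num.max 0 (pr (P : M) (A e)))%:E)%E.
  by apply: eq_integral => P _; rewrite max_r// pr_ge0.
rewrite E; apply: ae_eq_integral => //.
- by apply: (measurableT_comp mm); exact: measurable_polya_prod PV e.
- by apply/measurable_EFinP; exact: measurable_polya_prod PV e.
- by apply: filterS (polya_prod_ge0 PV e) => w w0 _; rewrite max_r.
Qed.

Lemma exists_mean_measure : exists G : probability BX R, mean_measure A Pr V G.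
Proof.
have [G GE] := mixture_probability Q; exists G => e.
by rewrite GE /mixture projection_mean.
Qed.

Variable G : probability BX R.
Hypothesis Gmean : mean_measure A Pr V G.

Lemma mean_measure_pr e : pr G (A e) = \int[Pr]_w polya_prod V e w.
Proof. by rewrite /pr Gmean. Qed.

Lemma mean_measure_gt0 e : 0 < pr G (A e).
Proof. by rewrite mean_measure_pr; exact: (polya_mean_gt0 beta0 PV). Qed.

Let menergy m : measurable_fun setT (fun P : M1tight X => energy A G m (P : M)).
Proof.
apply: measurable_sum => e; apply: measurable_funM => //.
by apply: measurable_funX; exact: (measurable_tight_pr (mA e)).
Qed.

Lemma integral_energy m : (\int[Q]_P (energy A G m (P : M))%:E =
  (\sum_(e : m.-tuple bool) \prod_(l < m) polya_term beta (tval e) l)%:E)%E.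
Proof.
rewrite /energy; under eq_integral do rewrite -sumEFin.
rewrite ge0_integral_sum//; last 2 first.
- move=> e; apply/measurable_EFinP; apply: measurable_funM => //.
  by apply: measurable_funX; exact: (measurable_tight_pr (mA e)).
- by move=> e P _; rewrite lee_fin divr_ge0 ?sqr_ge0// ltW// mean_measure_gt0.
rewrite -sumEFin; apply: eq_bigr => e _.
have m2 : measurable_fun setT (fun y : R => (y ^+ 2 / pr G (A e))%:E).
  by apply/measurable_EFinP; apply: measurable_funM => //; exact: measurable_funX.
rewrite (@projection_integral e (fun y => (y ^+ 2 / pr G (A e))%:E))//; last first.
  by move=> x; rewrite lee_fin divr_ge0 ?sqr_ge0// ltW// mean_measure_gt0.
have m2' : measurable_fun setT (fun y : R => (y ^+ 2)%:E).
  by apply/measurable_EFinP; exact: measurable_funX.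
(* Finiteness is checked on the side of [Q], where the integrand is at most 1 everywhere. *)
have fin : (\int[Pr]_w (polya_prod V e w ^+ 2)%:E)%E \is a fin_num.
  rewrite -(@projection_integral e (fun y => (y ^+ 2)%:E))//; last first.
    by move=> x; rewrite lee_fin sqr_ge0.
  apply: integrable_fin_num => //; apply: (@bounded_integrable _ _ _ Q _ 1).
    by apply: measurable_funX; exact: (measurable_tight_pr (mA e)).
  move=> P; rewrite ger0_norm ?sqr_ge0// exprn_ile1 ?pr_ge0//.
  exact: pr_le1.
transitivity ((\int[Pr]_w (polya_prod V e w ^+ 2)) / pr G (A e))%:E.
  under eq_integral do rewrite mulrC EFinM.
  rewrite ge0_integralZl//; last 3 first.
  - by apply: (measurableT_comp m2'); exact: measurable_polya_prod PV e.
  - by move=> w _; rewrite lee_fin sqr_ge0.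
  - by rewrite lee_fin invr_ge0 ltW// mean_measure_gt0.
  by rewrite -(fineK fin) -EFinM mulrC.
have -> := polya_second_moment beta0 PV e.
rewrite mean_measure_pr mulrAC divff ?mul1r ?gt_eqF//; last exact: (polya_mean_gt0 beta0 PV).
by congr EFin; rewrite -(big_mkord xpredT (polya_term beta e)) -(big_mkord xpredT (polya_term beta e)) size_tuple.
Qed.

(** By monotone convergence the limit [h] of the energies has integral at most [c], so it is finite
    almost everywhere; it bounds all energies by monotonicity. *)
Lemma energy_bounded_ae (c : R) :
  (forall m, (1 <= m)%N ->
    \sum_(e : m.-tuple bool) \prod_(l < m) polya_term beta (tval e) l <= c) ->
  {ae Q, forall P : M1tight X, exists n : nat, forall m, energy A G m (P : M) <= n%:R}.
Proof.
move=> hc.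
pose h (P : M1tight X) := limn (fun m => (energy A G m (P : M))%:E).
have nd P : nondecreasing_seq (fun m => (energy A G m (P : M))%:E).
  by move=> m n mn; rewrite lee_fin; apply: (energy_nd Atree Ares mean_measure_gt0).
have e0 m (P : M) : (0 <= (energy A G m P)%:E)%E by rewrite lee_fin (energy_ge0 mean_measure_gt0).
have cvh P : (fun m => (energy A G m (P : M))%:E) @ \oo --> h P.
  by apply: ereal_nondecreasing_is_cvgn; exact: nd.
have mh : measurable_fun setT h.
  apply: (emeasurable_fun_cvg (fun m (P : M1tight X) => (energy A G m (P : M))%:E)) => //.
  by move=> m; apply/measurable_EFinP; exact: menergy.
have ih : (\int[Q]_P h P <= c%:E)%E.
  rewrite /h monotone_convergence//; last first.
    by move=> m; apply/measurable_EFinP; exact: menergy.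
  apply: lime_le.
    by apply: ereal_nondecreasing_is_cvgn => m n mn; apply: ge0_le_integral => //;
      solve [apply/measurable_EFinP; exact: menergy | by move=> P _; exact: nd].
  exists 1%N => // m /= m1; rewrite integral_energy lee_fin; exact: hc.
have h0 P : (0 <= h P)%E by apply: lime_ge => //; exact: nearW.
have : Q.-integrable setT h.
  apply/integrableP; split => //; apply: le_lt_trans (ltry c).
  by under eq_integral do rewrite gee0_abs//.
move=> /(integrable_ae measurableT); apply: filterS => P /(_ I) fh.
exists (Num.truncn (fine (h P))).+1 => m.
have : ((energy A G m (P : M))%:E <= h P)%E.
  by apply: lime_ge; [exact: cvgP (cvh P)|exists m => // n mn; exact: nd].
rewrite -(fineK fh) lee_fin => /le_trans; apply; exact/ltW/truncnS_gt.
Qed.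

End projections.

(** * Regularity and uniqueness on cylinder sets *)

Section probability_limits.
Context d (T : measurableType d) (R : realType) (P : probability T R).

Lemma prob1_setI (B E : set T) : measurable B -> measurable E -> P E = 1%E ->
  P (B `&` E) = P B.
Proof.
move=> mB mE E1; have mI : measurable (B `&` E) by exact: measurableI.
have mI' : measurable (B `&` ~` E) by apply: measurableI => //; exact: measurableC.
have prE1 : pr P E = 1 by rewrite /pr E1.
have BE : B = (B `&` E) `|` (B `&` ~` E) by rewrite -setIUr setUv setIT.
rewrite !prE//; congr EFin; rewrite [in RHS]BE prU//; last by rewrite setIACA setICr setI0.
suff -> : pr P (B `&` ~` E) = 0 by rewrite addr0.
apply/eqP; rewrite eq_le pr_ge0 andbT.
have := le_pr P mI' (measurableC mE) (@subIsetr _ _ _).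
by rewrite pr_setC// prE1 subrr.
Qed.

Lemma pr_nondecreasing_approx (F : nat -> set T) (e : R) : (forall i, measurable (F i)) ->
  nondecreasing_seq F -> 0 < e -> exists n, pr P (\bigcup_i F i `\` F n) <= e.
Proof.
move=> mF ndF e0; have mU : measurable (\bigcup_i F i) by exact: bigcupT_measurable.
have : (fun n => pr P (F n)) @ \oo --> pr P (\bigcup_i F i).
  have h : (P (F n) @[n --> \oo] --> P (\bigcup_i F i))%E by exact: nondecreasing_cvg_mu.
  by move: h; rewrite prE// => /fine_cvg.
move=> /cvgrPdist_le/(_ _ e0)[n _ /(_ n (leqnn n))] /= h; exists n.
have sub : F n `<=` \bigcup_i F i by move=> x Fx; exists n.
have := prU P (mF n) (measurableD mU (mF n)) (setDIK _ _).
rewrite setDUK// => E; move: h; rewrite E addrAC subrr add0r.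
exact/le_trans/ler_norm.
Qed.

End probability_limits.

Section cylinder_regularity.
Context (R : realType) (X : pseudoPMetricType R) (A : seq bool -> set X).
Local Notation M := (M1 X).
Local Notation BX := (borelType X).
Hypothesis Ares : resolving A.
Variable Pi : probability (M1weak X) R.

(** The approximation property of Borel measures on metric spaces. Here it is started from the
    cylinder generators, which are weakly open and countable unions of weakly closed sets; other
    weak Borel sets are reached through their traces on energy balls. *)
Let regular : set (set M) := [set C | forall e : R, 0 < e ->
  exists F O : set M, [/\ weak_open (~` F), weak_open O, F `<=` C, C `<=` O &
    pr Pi (O `\` F : set (M1weak X)) <= e]].

Let mopen (O : set M) : weak_open O -> measurable (O : set (M1weak X)).
Proof. by move=> oO; exact: sub_sigma_algebra. Qed.

Let mclosed (F : set M) : weak_open (~` F) -> measurable (F : set (M1weak X)).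
Proof. by move=> /mopen oF; rewrite -[F]setCK; exact: measurableC. Qed.

Let regular_gen e (q : R) : regular [set P : M | q < pr P (A e)].
Proof.
move=> eps eps0.
pose F n : set M := [set P : M | q + n.+1%:R^-1 <= pr P (A e)].
have mA : measurable (A e : set BX) by exact: tree_measurable.
have cF n : weak_open (~` (F n)).
  have := @weak_open_pr _ _ (A e) [set y | y < q + n.+1%:R^-1] mA (@open_lt _ _).
  by congr weak_open; apply/seteqP; split => P /=; rewrite /F /= ltNge; [move/negP|move/negP].
have oO : weak_open [set P : M | q < pr P (A e)].
  exact: (@weak_open_pr _ _ (A e) [set y | q < y] mA (@open_gt _ _)).
have UE : [set P : M | q < pr P (A e)] = \bigcup_n F n.
  apply/seteqP; split => P /=.
    rewrite -subr_gt0 => qP; exists (Num.truncn (pr P (A e) - q)^-1) => //.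
    rewrite /F /= -lerBrDl -[leRHS]invrK lef_pV2 ?posrE ?invr_gt0//.
    exact/ltW/truncnS_gt.
  by move=> [n _]; rewrite /F/=; apply: lt_le_trans; rewrite ltrDl invr_gt0.
have ndF : nondecreasing_seq F.
  move=> m n mn; apply/subsetPset => P; rewrite /F /=; apply: le_trans.
  by rewrite lerD2l lef_pV2 ?posrE// ler_nat.
have [n hn] := @pr_nondecreasing_approx _ (M1weak X) R Pi F _ (fun i => mclosed (cF i)) ndF eps0.
exists (F n), [set P : M | q < pr P (A e)]; split => //.
- by rewrite UE => P FP; exists n.
- by rewrite UE.
Qed.

Let regular_sigma : sigma_algebra setT regular.
Proof.
split.
- move=> e e0; exists set0, set0; split => //.
  + by rewrite setC0; exact: weak_openT.
  + by rewrite setD0 pr0 ltW.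
- move=> C rC e e0; have [F [W [cF oO FC CO h]]] := rC e e0.
  exists (~` W), (~` F); split; rewrite ?setCK//.
  + by rewrite setTD; exact: subsetC.
  + by rewrite setTD; exact: subsetC.
  + by rewrite setDE setCK setIC -setDE.
move=> C rC e e0.
(* One half of [e] is shared out geometrically among the errors of the [C i]; the other half pays
   for passing from the countable union of the closed sets to a finite one, which is again
   closed. *)
have e2 : 0 < e / 2 by rewrite divr_gt0.
have ei i : 0 < e / 2 / (2 ^ i.+1)%:R by rewrite divr_gt0// ltr0n expn_gt0.
have h i : exists FO : set M * set M, [/\ weak_open (~` FO.1), weak_open FO.2,
    FO.1 `<=` C i, C i `<=` FO.2 &
    pr Pi (FO.2 `\` FO.1 : set (M1weak X)) <= e / 2 / (2 ^ i.+1)%:R].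
  by have [F [W FW]] := rC i _ (ei i); exists (F, W).
have [FO FOP] := choice h.
pose F i := (FO i).1; pose O i := (FO i).2.
have cF i : weak_open (~` F i) by have [] := FOP i.
have oO i : weak_open (O i) by have [] := FOP i.
have FC i : F i `<=` C i by have [] := FOP i.
have CO i : C i `<=` O i by have [] := FOP i.
have hi i : pr Pi (O i `\` F i : set (M1weak X)) <= e / 2 / (2 ^ i.+1)%:R by have [] := FOP i.
pose FN n : set M := \bigcup_(i in `I_n) F i.
have cFN n : weak_open (~` FN n).
  elim: n => [|n IH]; first by rewrite /FN II0 bigcup_set0 setC0; exact: weak_openT.
  rewrite (_ : FN n.+1 = FN n `|` F n); first exact: weak_closedU.
  by rewrite /FN IIS bigcup_setU bigcup_set1.
have ndF : nondecreasing_seq FN.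
  by move=> m n mn; apply/subsetPset => P [i /= im FP]; exists i => //=; exact: leq_trans mn.
have [n hn] := @pr_nondecreasing_approx _ (M1weak X) R Pi FN _ (fun i => mclosed (cFN i)) ndF e2.
exists (FN n), (\bigcup_i O i); split.
- exact: cFN.
- exact: weak_open_bigcup.
- by move=> P [i _ /FC CP]; exists i.
- by move=> P [i _ /CO CP]; exists i.
have mD i : measurable (O i `\` F i : set (M1weak X)).
  by apply: measurableD; [exact: mopen|exact: mclosed].
have mUD : measurable (\bigcup_i (O i `\` F i) : set (M1weak X)) by exact: bigcupT_measurable.
have mFN i : measurable (FN i : set (M1weak X)) by exact: mclosed.
have mUF : measurable ((\bigcup_i FN i) `\` FN n : set (M1weak X)).
  by apply: measurableD => //; exact: bigcupT_measurable.
have mO : measurable ((\bigcup_i O i) `\` FN n : set (M1weak X)).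
  by apply: measurableD => //; apply: bigcupT_measurable => i; exact: mopen.
have sub : (\bigcup_i O i) `\` FN n `<=` \bigcup_i (O i `\` F i) `|` (\bigcup_i FN i) `\` FN n.
  move=> P [[i _ OP] nFN]; have [FP|nFP] := pselect (F i P); last by left; exists i.
  by right; split => //; exists i.+1 => //; exists i => //=.
have hiE i : (Pi (O i `\` F i : set (M1weak X)) <= (e / 2 / (2 ^ i.+1)%:R)%:E)%E.
  by rewrite prE// lee_fin.
have b1 : pr Pi (\bigcup_i (O i `\` F i) : set (M1weak X)) <= e / 2.
  rewrite -lee_fin -prE//; apply: (le_trans (measure_sigma_subadditive _ _ mUD (fun=> id))) => //.
  apply: (@le_trans _ _ (\sum_(i <oo) (e / 2 / (2 ^ i.+1)%:R)%:E)%E).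
    by apply: lee_nneseries => // i *; exact: hiE.
  by apply: epsilon_trick0; exact: ltW.
rewrite (splitr e); apply: le_trans (lerD b1 hn).
apply: le_trans (le_pr Pi mO (measurableU _ _ mUD mUF) sub) _.
have := measureU2 Pi mUD mUF.
by rewrite [X in (X <= _)%E](prE Pi (measurableU _ _ mUD mUF)) [X in (_ <= X + _)%E](prE Pi mUD)
  [X in (_ <= _ + X)%E](prE Pi mUF) -EFinD lee_fin.
Qed.

Lemma cyl_inner_closed (C : set (M1cyl A)) (e : R) : measurable C -> 0 < e ->
  exists2 F : set M, weak_open (~` F) & F `<=` C /\
    pr Pi (C : set (M1weak X)) <= pr Pi (F : set (M1weak X)) + e.
Proof.
move=> mC e0.
have rC : regular C.
  move: mC; apply: smallest_sub; first exact: regular_sigma.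
  by move=> _ [x [q ->]]; exact: regular_gen.
have [F [W [cF oO FC CO h]]] := rC e e0; exists F => //; split => //.
have mC' : measurable (C : set (M1weak X)) by exact: weak_measurable_cyl.
have mF : measurable (F : set (M1weak X)) by exact: mclosed.
have mO : measurable (W : set (M1weak X)) by exact: mopen.
have := prU Pi mF (measurableD mO mF) (setDIK _ _).
rewrite setDUK; last exact: subset_trans FC CO.
by move=> E; apply: (le_trans (le_pr Pi mC' mO CO)); rewrite E lerD2l.
Qed.

End cylinder_regularity.

(** * Cylinder sets and finite-level histograms *)

Section histograms.
Context (R : realType) (X : pseudoPMetricType R) (A : seq bool -> set X).
Local Notation M := (M1 X).
Local Notation BX := (borelType X).
Hypothesis Atree : dyadic_tree A.
Hypothesis Ares : resolving A.

Lemma measurable_histogram m (B : set (m.-tuple bool -> R)) : borel_Em B ->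
  measurable ([set P : M | B (histogram A P)] : set (M1cyl A)).
Proof.
move: B; apply: smallest_sub.
  split => [|B mB|F mF].
  - exact: measurable0.
  - by rewrite setTD; exact: measurableC.
  - have h := @bigcupT_measurable _ (M1cyl A) _ mF; exact: h.
move=> _ [e [B [mB ->]]].
by have := @measurable_pr_cyl R X A (tval e) measurableT B mB; rewrite setTI.
Qed.

(** Finite intersections of the cylinder generators, possibly at different levels of the tree: the
    intersection-stable family on which two laws are compared. *)
Definition half_spaces : set (set M) :=
  [set C | exists s : seq (seq bool * R), C = [set P : M | forall t, t \in s -> t.2 < pr P (A t.1)]].

Lemma half_spaces_setI : setI_closed half_spaces.
Proof.
move=> _ _ [s ->] [s' ->]; exists (s ++ s'); apply/seteqP; split => P /=.
  by move=> [h h'] t; rewrite mem_cat => /orP[/h|/h'].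
by move=> h; split => t ts; apply: h; rewrite mem_cat ts ?orbT.
Qed.

Lemma half_spaces_gen : @measurable _ (M1cyl A) `<=` <<s half_spaces >>.
Proof.
apply: smallest_sub; first exact: smallest_sigma_algebra.
move=> _ [e [q ->]]; apply: sub_sigma_algebra; exists [:: (e, q)].
apply/seteqP; split => P /=; first by move=> h t; rewrite inE => /eqP->.
by move=> /(_ (e, q)); rewrite inE eqxx => /(_ isT).
Qed.

Lemma pr_tree_sum (P : M) m e : (size e <= m)%N ->
  pr P (A e) = \sum_(e' : m.-tuple bool | take (size e) e' == e) pr P (A e').
Proof.
move=> em; rewrite (pr_level Atree Ares P m (tree_measurable Ares e)) [RHS]big_mkcond/=.
apply: eq_bigr => e' _; case: ifPn => [/eqP eq|neq].
  congr pr; apply/setIidPr.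
  by rewrite -{1}(cat_take_drop (size e) e') eq; exact: tree_cat.
rewrite (_ : _ `&` _ = set0) ?pr0//.
apply/seteqP; split => // x [Ax Ax']; move/eqP : neq; apply.
apply/esym/(tree_inj Atree _ Ax); first by rewrite size_takel// size_tuple.
by move: Ax'; rewrite -{1}(cat_take_drop (size e) e'); exact: tree_cat.
Qed.

(** A histogram finer than all nodes involved determines their masses by summing over
    descendants. *)
Lemma half_spaces_histogram (C : set M) : half_spaces C ->
  exists m (B : set (m.-tuple bool -> R)), [/\ (1 <= m)%N, borel_Em B &
    C = [set P : M | B (histogram A P)]].
Proof.
(* The successor gives [1 <= m], also for the empty list; the projections are prescribed only from
   level 1 on. *)
move=> [s ->]; pose m := (\max_(t <- s) size t.1).+1.
pose B : set (m.-tuple bool -> R) := [set x | forall t, t \in s ->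
   t.2 < \sum_(e' : m.-tuple bool | take (size t.1) e' == t.1) x e'].
exists m, B; split => //; last first.
  have sz t : t \in s -> (size t.1 <= m)%N by move=> ts; rewrite ltnW// ltnS (leq_bigmax_seq _ ts).
  apply/seteqP; split => P /= h t ts; have := h t ts; rewrite (pr_tree_sum P (sz t ts)) //.
have gm : forall t : seq bool * R, borel_Em
    [set x | t.2 < \sum_(e' : m.-tuple bool | take (size t.1) e' == t.1) x e'].
  move=> t.
  pose TT := g_sigma_algebraType [set C | exists (e : m.-tuple bool) (B : set R),
          measurable B /\ C = [set x : m.-tuple bool -> R | B (x e)]].
  have mcoord (e : m.-tuple bool) : measurable_fun setT (fun x : TT => x e).
    by move=> _ D mD; rewrite setTI; apply: sub_sigma_algebra; exists e, D.
  have ms : measurable_fun setT (fun x : TT => \sum_(e' : m.-tuple bool | take (size t.1) e' == t.1) x e').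
    apply: (eq_measurable_fun (fun x : TT =>
        \sum_(e' : m.-tuple bool) if take (size t.1) e' == t.1 then x e' else 0)).
      by move=> x _; rewrite [RHS]big_mkcond.
    by apply: measurable_sum => e; case: (take (size t.1) e == t.1); [exact: mcoord|exact: measurable_cst].
  have := ms measurableT _ (measurable_itv `]t.2, +oo[); rewrite setTI.
  by congr (_ _); apply/seteqP; split => x /=; rewrite in_itv/= andbT.
rewrite /B; elim: (s) => [|t s' IH].
  rewrite (_ : [set x | _] = setT); last by apply/seteqP; split.
  exact: (@measurableT _ (g_sigma_algebraType _)).
rewrite (_ : [set x | _] = [set x | t.2 < \sum_(e' : m.-tuple bool | take (size t.1) e' == t.1) x e']
  `&` [set x | forall t, t \in s' -> t.2 < \sum_(e' : m.-tuple bool | take (size t.1) e' == t.1) x e']).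
  exact: (@measurableI _ (g_sigma_algebraType _) _ _ (gm t) IH).
apply/seteqP; split => x /=.
  by move=> h; split => [|t' t's]; apply: h; rewrite inE ?eqxx ?t's ?orbT.
by move=> [h h'] t'; rewrite inE => /orP[/eqP->//|]; exact: h'.
Qed.

End histograms.

(** * The law on the weak space *)

Section weak_law.
Context (R : realType) (X : pseudoPMetricType R) (A : seq bool -> set X)
  (beta : seq bool -> R) (dO : measure_display) (Om : measurableType dO)
  (Pr : probability Om R) (V : seq bool -> Om -> R).
Local Notation M := (M1 X).
Local Notation BX := (borelType X).
Hypothesis Atree : dyadic_tree A.
Hypothesis Ares : resolving A.
Hypothesis beta0 : forall e b, 0 < beta (rcons e b).
Hypothesis PV : polya_variables beta Pr V.
Variable Q : probability (M1tight X) R.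
Hypothesis Qproj : forall m, projects_to A Pr V Q m.
Variable c : R.
Hypothesis hc : forall m, (1 <= m)%N ->
    \sum_(e : m.-tuple bool) \prod_(l < m) polya_term beta (tval e) l <= c.
Variable G : probability BX R.
Hypothesis Gmean : mean_measure A Pr V G.

Let G0 e : 0 < pr G (A e) := mean_measure_gt0 beta0 PV Gmean e.

Definition energy_ball (n : nat) : set M := [set P | forall m, energy A G m P <= n%:R].

Definition energy_finite : set M := \bigcup_n energy_ball n.

Lemma energy_ball_dominated n : energy_ball n `<=` quad_dominated G n%:R.
Proof. by move=> P; exact: (energy_quad_dominated Atree Ares G0). Qed.

Lemma energy_ball_cyl n : measurable (energy_ball n : set (M1cyl A)).
Proof.
rewrite (_ : energy_ball n = \bigcap_m [set P : M | energy A G m P <= n%:R]); last first.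
  by apply/seteqP; split => P h m; have := h m => // /(_ I).
apply: bigcapT_measurable => m.
have mE : measurable_fun setT (fun P : M1cyl A => energy A G m (P : M)).
  apply: measurable_sum => e; apply: measurable_funM => //; apply: measurable_funX.
  exact: measurable_pr_cyl.
have := mE measurableT _ (measurable_itv `]-oo, n%:R]); rewrite setTI.
by congr measurable; apply/seteqP; split => P /=; rewrite in_itv.
Qed.

Lemma energy_ball_nd : nondecreasing_seq energy_ball.
Proof.
move=> m n mn; apply/subsetPset => P h k; apply: le_trans (h k) _.
by rewrite ler_nat.
Qed.

Lemma energy_finite_cyl : measurable (energy_finite : set (M1cyl A)).
Proof. by apply: bigcupT_measurable => n; exact: energy_ball_cyl. Qed.

Lemma energy_finite_trace (B : set (M1weak X)) : measurable B ->
  measurable (B `&` energy_finite : set (M1cyl A)).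
Proof.
move=> mB; rewrite setI_bigcupr; apply: bigcupT_measurable => n.
exact: (cyl_weak_measurable Atree Ares (@energy_ball_dominated n) (energy_ball_cyl n)).
Qed.

Lemma energy_finite_prob1 : Q energy_finite = 1%E.
Proof.
have mE : measurable (energy_finite : set (M1tight X)).
  exact: (tight_measurable_cyl Ares) energy_finite_cyl.
have Q0 : Q (~` energy_finite) = 0%E.
  have [N [mN N0 sub]] := energy_bounded_ae Atree Ares beta0 PV Qproj Gmean hc.
  apply/eqP; rewrite eq_le measure_ge0 andbT -N0.
  apply: le_measure; rewrite ?inE//; first exact: measurableC.
  by move=> P nP; apply: sub => -[n h]; apply: nP; exists n.
have := probability_setC Q mE; rewrite Q0 => E.
have Qf : Q energy_finite \is a fin_num by exact: fin_num_measure.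
by move: E; rewrite -(fineK Qf) -EFinB => -[/eqP]; rewrite eq_sym subr_eq0 => /eqP <-.
Qed.

(* Nonmeasurable sets get mass 0: points of [M1 X] that differ only on nonmeasurable
   sets are topologically indistinguishable, so weakly compact sets need not be
   measurable, and they must not contribute to the supremum defining [radon]. *)
Let weak_law_fun (B : set (M1weak X)) : \bar R :=
  if `[< measurable B >] then Q (B `&` energy_finite : set (M1tight X)) else 0%E.

Let weak_law_funE B : measurable B ->
  weak_law_fun B = Q (B `&` energy_finite : set (M1tight X)).
Proof. by move=> mB; rewrite /weak_law_fun; case: asboolP. Qed.

Let tight_trace (B : set (M1weak X)) : measurable B ->
  measurable (B `&` energy_finite : set (M1tight X)).
Proof. by move=> mB; exact: (tight_measurable_cyl Ares) (energy_finite_trace mB). Qed.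

Let weak_law0 : weak_law_fun set0 = 0%E.
Proof. by rewrite weak_law_funE// set0I measure0. Qed.

Let weak_law_ge0 B : (0 <= weak_law_fun B)%E.
Proof. by rewrite /weak_law_fun; case: asboolP. Qed.

Let weak_law_sigma : semi_sigma_additive weak_law_fun.
Proof.
move=> F mF tF mU; rewrite weak_law_funE//.
have -> : (fun n => \sum_(0 <= i < n) weak_law_fun (F i))%E =
    (fun n => \sum_(0 <= i < n) Q (F i `&` energy_finite : set (M1tight X)))%E.
  by apply/funext => n; apply: eq_bigr => i _; rewrite weak_law_funE.
rewrite setI_bigcupl; apply: measure_semi_sigma_additive.
- by move=> i; exact: tight_trace.
- exact: trivIset_setIr.
- by rewrite -setI_bigcupl; exact: tight_trace.
Qed.

Let weak_lawT : weak_law_fun setT = 1%E.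
Proof. by rewrite weak_law_funE// setTI energy_finite_prob1. Qed.

Lemma weak_law_exists : exists Pi : probability (M1weak X) R,
  (forall B : set (M1weak X), measurable B -> Pi B = Q (B `&` energy_finite : set (M1tight X))) /\
  (forall B : set (M1weak X), ~ measurable B -> Pi B = 0%E).
Proof.
pose P1 : {measure set (M1weak X) -> \bar R} :=
  HB.pack weak_law_fun (isMeasure.Build _ _ _ weak_law_fun weak_law0 weak_law_ge0 weak_law_sigma).
have PT1 : P1 setT = 1%E by exact: weak_lawT.
pose P2 : probability (M1weak X) R := HB.pack (Measure.sort P1)
  (Measure_isProbability.Build _ _ _ (Measure.sort P1) PT1).
exists P2; split => B mB; first exact: weak_law_funE.
by rewrite [LHS]/(weak_law_fun B) /weak_law_fun; case: asboolP.
Qed.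

Variable Pi : probability (M1weak X) R.
Hypothesis PiE : forall B : set (M1weak X), measurable B ->
  Pi B = Q (B `&` energy_finite : set (M1tight X)).
Hypothesis PiN : forall B : set (M1weak X), ~ measurable B -> Pi B = 0%E.

Lemma weak_law_cyl (C : set (M1cyl A)) : measurable C -> Pi C = Q C.
Proof.
move=> mC; rewrite PiE; last exact: weak_measurable_cyl.
have mC' : measurable (C : set (M1tight X)) by exact: (tight_measurable_cyl Ares).
have mE : measurable (energy_finite : set (M1tight X)).
  exact: (tight_measurable_cyl Ares) energy_finite_cyl.
by rewrite prob1_setI//; exact: energy_finite_prob1.
Qed.

Lemma weak_law_projects m : projects_to A Pr V Pi m.
Proof.
move=> B mB; rewrite weak_law_cyl; first exact: Qproj.
exact: measurable_histogram.
Qed.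

Lemma weak_law_energy_finite : Pi energy_finite = 1%E.
Proof. by rewrite weak_law_cyl ?energy_finite_prob1//; exact: energy_finite_cyl. Qed.

(** Half of [e] is lost in cutting [B] to an energy ball, half in passing to a weakly closed subset
    of the resulting cylinder set. That subset is compact as a closed subset of a compact dominated
    set. *)
Lemma weak_law_radon : radon Pi.
Proof.
move=> B mB; apply/eqP; rewrite eq_le; apply/andP; split; last first.
  apply: ub_ereal_sup => _ [K [_ KB] <-].
  have [mK|nK] := pselect (measurable (K : set (M1weak X))); last by rewrite PiN.
  by apply: le_measure; rewrite ?inE.
apply/lee_addgt0Pr => e e0; have e2 : 0 < e / 2 by rewrite divr_gt0.
pose F n : set (M1weak X) := B `&` energy_ball n.
have mFc n : measurable (F n : set (M1cyl A)).
  exact: (cyl_weak_measurable Atree Ares (@energy_ball_dominated n) (energy_ball_cyl n)).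
have mF n : measurable (F n) by exact: (weak_measurable_cyl Ares).
have ndF : nondecreasing_seq F.
  by move=> m n mn; apply/subsetPset; apply: setIS; apply/subsetPset; exact: energy_ball_nd.
have [n hn] := pr_nondecreasing_approx Pi mF ndF e2.
have [C cC [CF hC]] := cyl_inner_closed Ares Pi (mFc n) e2.
have mC : measurable (C : set (M1weak X)).
  by rewrite -[C]setCK; apply: measurableC; exact: sub_sigma_algebra.
apply: (@le_trans _ _ (Pi C + e%:E)%E); last first.
  rewrite leeD2r//; apply: ereal_sup_ubound; exists C => //; split.
    apply: (gen_compact_closed (@quad_dominated_compact _ _ G n%:R) cC).
    by move=> P /CF[_ /energy_ball_dominated].
  by move=> P /CF[].
have mUF : measurable (\bigcup_i F i) by exact: bigcupT_measurable.
have -> : Pi B = Pi (\bigcup_i F i).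
  by rewrite !PiE// -setI_bigcupr -/energy_finite -setIA setIid.
have sub : F n `<=` \bigcup_i F i by move=> P FP; exists n.
have := prU Pi (mF n) (measurableD mUF (mF n)) (setDIK _ _); rewrite setDUK// => E.
rewrite !prE// -EFinD lee_fin E.
move: hn hC; set x := pr Pi (_ `\` _); set y := pr Pi (F n); set z := pr Pi C => hn hC.
by rewrite (splitr e) addrA lerD.
Qed.

(** Agreement on cylinder sets already gives [energy_finite] mass 1 under [Pi'], and traces of weak
    Borel sets on it are cylinder sets. *)
Lemma weak_law_unique (Pi' : probability (M1weak X) R) :
  (forall m, (1 <= m)%N -> projects_to A Pr V Pi' m) ->
  forall B : set (M1weak X), measurable B -> Pi' B = Pi B.
Proof.
move=> Pi'proj.
have hs C : half_spaces A C -> Pi' C = Pi C.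
  move=> /(half_spaces_histogram Atree Ares)[m [B [m1 mB ->]]].
  by rewrite Pi'proj// weak_law_projects.
have mhs : half_spaces A `<=` @measurable _ (M1weak X).
  move=> C /(half_spaces_histogram Atree Ares)[m [B [m1 mB ->]]].
  by apply: (weak_measurable_cyl Ares); exact: measurable_histogram.
have cyl (C : set (M1cyl A)) : measurable C -> Pi' C = Pi C.
  move=> mC.
  apply: (@g_sigma_algebra_measure_unique _ R (M1weak X) (half_spaces A) mhs (fun _ : nat => setT) _ _ Pi' Pi).
  - by move=> _; exists [::]; apply/seteqP; split.
  - by rewrite bigcup_const//; exists 0%N.
  - exact: half_spaces_setI.
  - exact: hs.
  - by move=> _; rewrite ltey_eq fin_num_measure.
  - exact: half_spaces_gen.
move=> B mB.
have mE : measurable (energy_finite : set (M1weak X)).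
  exact: (weak_measurable_cyl Ares) energy_finite_cyl.
have Pi'E : Pi' energy_finite = 1%E.
  by rewrite cyl; [exact: weak_law_energy_finite|exact: energy_finite_cyl].
rewrite -(prob1_setI mB mE Pi'E) -(prob1_setI mB mE weak_law_energy_finite).
by apply: cyl; exact: energy_finite_trace.
Qed.

Lemma weak_law_dominated (G' : probability BX R) : mean_measure A Pr V G' ->
  Pi [set P : M | P `<< G'] = 1%E.
Proof.
move=> G'mean.
(* Mean measures are prescribed on tree sets only, but the energies involve nothing else, so the
   bounds for [G] hold verbatim for [G']. *)
have GG e : pr G' (A e) = pr G (A e).
  by rewrite (mean_measure_pr G'mean) (mean_measure_pr Gmean).
(* Failure of absolute continuity is witnessed by one [G']-null set [B], and having positive mass on
   [B] is a weakly open condition; the set of dominated [P] is thus closed, hence measurable. *)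
have oD : weak_open (~` [set P : M | P `<< G']).
  apply: weak_open_local => P /= nP.
  have [B [mB B0 PB]] : exists B : set BX, [/\ measurable B, G' B = 0%E & P B <> 0%E].
    apply: contrapT => h; apply: nP; apply/null_content_dominatesP => B mB B0.
    by apply: contrapT => PB; apply: h; exists B.
  exists [set P' : M | [set y : R | 0 < y] (pr P' B)]; split.
  - by apply: weak_open_pr => //; exact: open_gt.
  - rewrite /= lt_neqAle pr_ge0 andbT eq_sym; apply/eqP => PB0; apply: PB.
    by rewrite prE// PB0.
  - move=> P' /= P'B /null_content_dominatesP /(_ B mB B0) P'0.
    by move: P'B; rewrite /pr P'0 ltxx.
have mD : measurable ([set P : M | P `<< G'] : set (M1weak X)).
  by rewrite -[X in measurable X]setCK; apply: measurableC; exact: sub_sigma_algebra.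
have mE : measurable (energy_finite : set (M1weak X)).
  exact: (weak_measurable_cyl Ares) energy_finite_cyl.
apply/eqP; rewrite eq_le probability_le1//= -weak_law_energy_finite.
apply: le_measure; rewrite ?inE// => P [n _ nP] /=.
have G'0 e : 0 < pr G' (A e) by rewrite GG.
have dom : quad_dominated G' n%:R P.
  apply: (energy_quad_dominated Atree Ares G'0) => m.
  by rewrite /energy; under eq_bigr do rewrite GG; exact: nP.
apply/null_content_dominatesP => B mB B0.
have := dom B mB; rewrite {2}/pr B0 mulr0 => P2.
rewrite prE//; congr EFin; apply/eqP; rewrite -sqrf_eq0 eq_le P2.
exact: sqr_ge0.
Qed.

End weak_law.

Theorem mainTheorem16 (R : realType) (X : pseudoPMetricType R)
  (U : set (set X)) (A : seq bool -> set X) (beta : seq bool -> R)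
  (dO : measure_display) (Om : measurableType dO) (Pr : probability Om R)
  (V : seq bool -> Om -> R) :
  hausdorff_space X ->
  countable U -> basis U ->
  dyadic_tree A ->
  (forall e, generated_by U (A e)) ->
  resolving A ->
  (forall e b, 0 < beta (rcons e b)) ->
  polya_variables beta Pr V ->
  (exists Q : probability (M1tight X) R,
      forall m : nat, projects_to A Pr V Q m) ->
  (exists C : R, forall m : nat, (1 <= m)%N ->
      \sum_(e : m.-tuple bool) \prod_(l < m) polya_term beta (tval e) l <= C) ->
  exists Pi : probability (M1weak X) R,
    [/\ radon Pi,
        (forall m : nat, (1 <= m)%N -> projects_to A Pr V Pi m),
        (forall Pi' : probability (M1weak X) R, radon Pi' ->
           (forall m : nat, (1 <= m)%N -> projects_to A Pr V Pi' m) ->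
           forall B : set (M1weak X), measurable B -> Pi' B = Pi B),
        (exists G : probability (borelType X) R, mean_measure A Pr V G)
      & (forall G : probability (borelType X) R, mean_measure A Pr V G ->
           Pi [set P : M1 X | P `<< G] = 1%E)].
Proof.
move=> _ _ _ Atree _ Ares beta0 PV [Q Qproj] [c hc].
have [G Gmean] := exists_mean_measure Ares PV Qproj.
have [Pi [PiE PiN]] := weak_law_exists Atree Ares beta0 PV Qproj hc Gmean.
exists Pi; split.
- exact: (weak_law_radon Atree Ares beta0 PV Gmean PiE PiN).
- by move=> m _; exact: (weak_law_projects Atree Ares beta0 PV Qproj hc Gmean PiE).
- by move=> Pi' _; exact: (weak_law_unique Atree Ares beta0 PV Qproj hc Gmean PiE).
- by exists G.
- exact: (weak_law_dominated Atree Ares beta0 PV Qproj hc Gmean PiE).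
Qed.
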